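(* There exists a universal constant $c>0$ such that for every integer $n\ge 3$ there exists a centrally-symmetric convex body $T\subseteq\mathbb{R}^n$ such that, for every real $p\ge 1$, $$d_{\rm ovr}(T,L_p^n)\;\ge\; c\,\frac{\sqrt{n}}{\sqrt{p\log\log n}}.$$
   Context: $(x,y)$ is the standard scalar product in $\mathbb{R}^n$, $S^{n-1}$ the Euclidean unit sphere centered at the origin, $\log$ the natural logarithm, and $|K|$ denotes volume. A convex body is a compact convex set with non-empty interior; it is centrally-symmetric if $D=-D$; $\|x\|_D=\inf\{a\ge 0: x\in aD\}$. The class $L_p^n$ of unit balls of $n$-dimensional subspaces of $L_p$ is, equivalently, the class of all centrally-symmetric convex bodies $D\subseteq\mathbb{R}^n$ for which there is a finite Borel measure $\nu_D$ on $S^{n-1}$ with $\|x\|_D^p=\int_{S^{n-1}}|(x,\theta)|^p\,d\nu_D(\theta)$ for all $x\in\mathbb{R}^n$. For a convex body $K\subseteq\mathbb{R}^n$, $$d_{\rm ovr}(K,L_p^n)=\inf\Big\{\Big(\frac{|D|}{|K|}\Big)^{1/n}: K\subseteq D,\ D\in L_p^n\Big\}.$$ *)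

(* Defs.v *)
From mathcomp Require Import all_boot all_order all_algebra.
From mathcomp Require Import all_classical all_reals all_analysis.
Set Implicit Arguments.
Unset Strict Implicit.
Unset Printing Implicit Defensive.
Import Order.TTheory GRing.Theory Num.Theory.
Import numFieldNormedType.Exports.

Local Open Scope classical_set_scope.
Local Open Scope ring_scope.

(** Vectors of R^n are rows ['rV[R]_n], with the library's (product) topology. *)

Definition dotv (R : realType) n (x y : 'rV[R]_n) : R :=
  \sum_(i < n) x 0 i * y 0 i.

Definition unit_sphere (R : realType) n : set 'rV[R]_n :=
  [set theta | Num.sqrt (dotv theta theta) = 1].

Definition borel (R : realType) n := g_sigma_algebraType (@open 'rV[R]_n).

(** The n-fold product of the one-dimensional Lebesgue measure. On 0-tuples the
    empty product is the unit mass at the only point. *)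
Fixpoint lebesgue_tuple (R : realType) n :
    set (n.-tuple (measurableTypeR R)) -> \bar R :=
  match n with
  | 0 => \d_ [tuple]
  | n'.+1 => pushforward (@lebesgue_measure R \x @lebesgue_tuple R n')%E
      (fun p => [tuple of p.1 :: p.2])
  end.

Definition volume (R : realType) n (A : set 'rV[R]_n) : \bar R :=
  lebesgue_tuple [set t : n.-tuple (measurableTypeR R) |
                   A (\row_(i < n) tnth t i)].

Definition convex_body (R : realType) n (K : set 'rV[R]_n) :=
  [/\ compact K, convex_set K & K° !=set0].

Definition symmetric_convex_body (R : realType) n (D : set 'rV[R]_n) :=
  convex_body D /\ D = [set - x | x in D].

Definition gauge (R : realType) n (D : set 'rV[R]_n) (x : 'rV[R]_n) : R :=
  inf [set a : R | 0 <= a /\ [set a *: y | y in D] x].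

(** A finite Borel measure on the sphere is given as a finite Borel measure [nu]
    on R^n: the integral over the sphere only sees its restriction to it, and
    every finite Borel measure on the sphere is such a restriction. *)
Definition Lp_class (R : realType) n (p : R) : set (set 'rV[R]_n) :=
  [set D | symmetric_convex_body D /\
    exists nu : {finite_measure set (borel R n) -> \bar R},
      forall x : 'rV[R]_n,
        ((gauge D x `^ p)%:E =
         \int[nu]_(theta in @unit_sphere R n) (`|dotv x theta| `^ p)%:E)%E].

(** Division and powers are those of the extended reals; the infimum of the
    empty set would be [+oo]. *)
Definition d_ovr (R : realType) n (K : set 'rV[R]_n)
    (L : set (set 'rV[R]_n)) : \bar R :=
  ereal_inf [set ((volume D / volume K) `^ (n%:R^-1))%E |
              D in [set D | K `<=` D /\ L D]].

(* Main.v *)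
Require Import Defs.
From HB Require Import structures.
From mathcomp Require Import all_boot all_order all_algebra.
From mathcomp Require Import all_classical all_reals all_analysis.
From mathcomp Require Import measurable_realfun.
From mathcomp Require Import ring lra.
Set Implicit Arguments.
Unset Strict Implicit.
Unset Printing Implicit Defensive.
Import Order.TTheory GRing.Theory Num.Theory.
Import numFieldNormedType.Exports.
Local Open Scope classical_set_scope.
Local Open Scope ring_scope.

(** Let [x_1, ..., x_N] be random sign vectors together with the unit vectors of
    R^n, [N] of order [n log n], and let [T] be their absolutely convex hull.

    Spreading: a union bound over a grid of mesh of order [1 / n] shows that some
    choice of the signs satisfies [(1 / N) sum_i |(x_i, theta)| >= 1 / 100] for
    every unit [theta]. The length [n log n], rather than [n], is what makes this
    crude net sufficient; it costs the factor [sqrt (log log n)] below.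

    [T] is small: after scaling by [k = n / L], [L = log (N / n)], the
    coefficients of a point of [T] can be rounded to integers [m_i] of total
    absolute value about [k], at Euclidean distance about [sqrt (k n)] (Maurey's
    argument). Hence the indicator of [T] is at most a mixture of Gaussian
    densities centred at [sum_i m_i x_i / k], with weights [exp (- L |m_i|)], and
    integrating gives [|T|^(1/n) <= C sqrt (L / n)].

    [D] is large: if [D] contains [T] and [||x||_D^p] is the integral of
    [|(x, theta)|^p] against [nu], then averaging [||x_i||_D^p <= 1] over [i]
    gives [nu(S) <= 100^p]. A centred Gaussian vector [G] with standard deviation
    [h] of order [1 / sqrt p] then satisfies [E ||G||_D^p <= 1 / 2], so [D] has
    Gaussian measure at least [1 / 2], and [|D|] is at least [h^n]. *)

(** * Lebesgue measure on tuples *)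

Section lebesgue_tuple_measure.
Context {R : realType}.
Local Notation mR := (measurableTypeR R).

Definition pair_cons n (p : mR * n.-tuple mR) : n.+1.-tuple mR :=
  [tuple of p.1 :: p.2].

Lemma measurable_pair_cons n : measurable_fun setT (@pair_cons n).
Proof. exact: measurable_cons. Qed.

Section cons_measure.
Variables (n : nat) (mu : {sigma_finite_measure set (n.-tuple mR) -> \bar R}).

Definition cons_measure : set (n.+1.-tuple mR) -> \bar R :=
  pushforward (@lebesgue_measure R \x mu)%E (@pair_cons n).

Let cons_measure0 : cons_measure set0 = 0%E.
Proof. by rewrite /cons_measure /pushforward preimage_set0 measure0. Qed.

Let cons_measure_ge0 A : (0 <= cons_measure A)%E.
Proof. by rewrite /cons_measure /pushforward; exact: measure_ge0. Qed.

Let cons_measure_sigma_additive : semi_sigma_additive cons_measure.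
Proof.
have mf := @measurable_pair_cons n.
rewrite /cons_measure => F mF tF mUF.
apply: (@measure_semi_sigma_additive _ _ _
  (pushforward (@lebesgue_measure R \x mu)%E (@pair_cons n))) => //.
Qed.

HB.instance Definition _ := isMeasure.Build _ _ _ cons_measure
  cons_measure0 cons_measure_ge0 cons_measure_sigma_additive.

Let cons_measure_sigma_finite : sigma_finite setT cons_measure.
Proof.
have /sigma_finiteP[F [FT ndF Foo]] := sigma_finiteT (@lebesgue_measure R).
have /sigma_finiteP[G [GT ndG Goo]] := sigma_finiteT mu.
pose uncons (t : n.+1.-tuple mR) : mR * n.-tuple mR := (thead t, [tuple of behead t]).
have unconsK : cancel (@pair_cons n) uncons.
  by case=> x t; rewrite /uncons /pair_cons /= theadE; congr (_, _); exact: val_inj.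
have muncons : measurable_fun setT uncons.
  apply/measurable_fun_pairP; split; first exact: measurable_tnth.
  exact: measurable_behead.
exists (fun i => uncons @^-1` (F i `*` G i)).
  rewrite -preimage_bigcup; apply/esym; rewrite -subTset => t _ /=.
  have [i _ Fi] : (\bigcup_i F i) (uncons t).1 by rewrite -FT.
  have [j _ Gj] : (\bigcup_j G j) (uncons t).2 by rewrite -GT.
  (* Both exhausting sequences are increasing, so the larger index serves both coordinates. *)
  exists (maxn i j) => //; split.
    by move: Fi; exact/subsetPset/ndF/leq_maxl.
  by move: Gj; exact/subsetPset/ndG/leq_maxr.
move=> i; have [mF Fi] := Foo i; have [mG Gi] := Goo i; split.
  by rewrite -[X in measurable X]setTI; apply: muncons => //; exact: measurableX.
rewrite /cons_measure /pushforward -comp_preimage.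
rewrite (_ : uncons \o _ = id); last by apply/funext => x /=; rewrite unconsK.
by rewrite preimage_id product_measure1E// lte_mul_pinfty// ge0_fin_numE.
Qed.

HB.instance Definition _ := Measure_isSigmaFinite.Build _ _ _ cons_measure
  cons_measure_sigma_finite.

Lemma ge0_integral_cons_measure (f : n.+1.-tuple mR -> \bar R) :
  measurable_fun setT f -> (forall t, 0 <= f t)%E ->
  (\int[cons_measure]_t f t
   = \int[@lebesgue_measure R]_x \int[mu]_t f (pair_cons (x, t)))%E.
Proof.
move=> mf f0; rewrite /cons_measure ge0_integral_pushforward//; last 1 first.
  exact: measurable_pair_cons.
rewrite preimage_setT fubini_tonelli1 //; last by move=> x /=.
by apply: measurableT_comp => //; exact: measurable_pair_cons.
Qed.

End cons_measure.

Definition point_measure : set (0.-tuple mR) -> \bar R := \d_ [tuple].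
HB.instance Definition _ := Measure.on point_measure.
Let point_sigma_finite : sigma_finite setT point_measure.
Proof. by apply: fin_num_fun_sigma_finite; [rewrite measure0|exact: fin_num_measure]. Qed.
HB.instance Definition _ := Measure_isSigmaFinite.Build _ _ _ point_measure
  point_sigma_finite.

(** The recursion of [lebesgue_tuple], carrying the sigma-finite structure that Tonelli's theorem
    requires. *)
Fixpoint lebesgue_rec n : {sigma_finite_measure set (n.-tuple mR) -> \bar R} :=
  match n with
  | 0 => point_measure
  | n'.+1 => cons_measure (lebesgue_rec n')
  end.

Lemma lebesgue_tupleE n : @lebesgue_tuple R n = lebesgue_rec n.
Proof. by elim: n => //= n ->. Qed.

End lebesgue_tuple_measure.

(** * Product densities, and measurability of closed sets of vectors *)

Section volume.
Context {R : realType}.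
Local Notation mR := (measurableTypeR R).

Lemma measurable_fun_prod_tnth n (f : 'I_n -> R -> R) :
  (forall i, measurable_fun setT (f i)) ->
  measurable_fun setT (fun t : n.-tuple mR => \prod_i f i (tnth t i)).
Proof.
move=> mf.
apply: (@measurable_prod _ (n.-tuple mR) R setT 'I_n (index_enum _)
  (fun i (t : n.-tuple mR) => f i (tnth t i))) => i _.
by apply: (measurableT_comp (mf i)) => //; exact: measurable_tnth.
Qed.

Lemma integral_prod_density n (f : 'I_n -> R -> R) :
  (forall i, measurable_fun setT (f i)) -> (forall i x, 0 <= f i x) ->
  (forall i, \int[@lebesgue_measure R]_x (f i x)%:E = 1)%E ->
  (\int[@lebesgue_rec R n]_t (\prod_i f i (tnth t i))%:E = 1)%E.
Proof.
elim: n f => [|n IHn] f mf f0 f1.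
  rewrite integral_dirac//=; last first.
    by apply/measurable_EFinP; exact: measurable_fun_prod_tnth.
  by rewrite diracT mul1e big_ord0.
rewrite ge0_integral_cons_measure; last 2 first.
- by apply/measurable_EFinP; exact: measurable_fun_prod_tnth.
- by move=> t; rewrite lee_fin; apply: prodr_ge0.
rewrite -[RHS](f1 ord0); apply: eq_integral => x _.
transitivity (\int[@lebesgue_rec R n]_t
    ((f ord0 x)%:E * (\prod_(i < n) f (lift ord0 i) (tnth t i))%:E))%E.
  apply: eq_integral => t _; rewrite -EFinM big_ord_recl; congr (_ * _)%:E.
  by apply: eq_bigr => i _; rewrite tnthS.
rewrite ge0_integralZl//.
- by rewrite (IHn (fun i => f (lift ord0 i))) ?mule1.
- apply/measurable_EFinP.
  exact: (measurable_fun_prod_tnth (f := fun i => f (lift ord0 i))).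
- by move=> t _; rewrite lee_fin; apply: prodr_ge0.
- by rewrite lee_fin.
Qed.

(** Tuples carry the product sigma-algebra, so closedness has to be made countable: at each scale
    [1 / k.+1] the set is covered by the grid cubes that meet it, and a point covered at every scale
    lies in the closure of [A]. *)
Lemma measurable_closed_tuple n (A : set 'rV[R]_n) : closed A ->
  measurable [set t : n.-tuple mR | A (\row_i tnth t i)].
Proof.
move=> cA.
pose near_grid k (q : 'rV[int]_n) := [set t : n.-tuple mR |
  forall i, `|tnth t i - (q 0 i)%:~R / k.+1%:R| <= k.+1%:R^-1].
pose meets k (q : 'rV[int]_n) := exists2 y, A y &
  forall i, `|y 0 i - (q 0 i)%:~R / k.+1%:R| <= k.+1%:R^-1.
have -> : [set t : n.-tuple mR | A (\row_i tnth t i)] =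
    \bigcap_k \bigcup_(q in meets k) near_grid k q.
  apply/seteqP; split => t /=.
    move=> At k _.
    have grid (x : R) :
        `|x - (Num.floor (x * k.+1%:R))%:~R / k.+1%:R| <= k.+1%:R^-1.
      have k0 : 0 < k.+1%:R :> R by [].
      have -> : x - (Num.floor (x * k.+1%:R))%:~R / k.+1%:R =
          (x * k.+1%:R - (Num.floor (x * k.+1%:R))%:~R) / k.+1%:R by field.
      have /andP[fl fu] := floor_itv (x * k.+1%:R).
      rewrite normrM [X in _ * X]ger0_norm ?invr_ge0// ler_piMl ?invr_ge0//.
      rewrite intrD in fu; rewrite ger0_norm; lra.
    exists (\row_i Num.floor (tnth t i * k.+1%:R)) => /=.
      by exists (\row_i tnth t i) => // i; rewrite !mxE.
    by move=> i; rewrite !mxE.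
  move=> tA; apply: cA => B /nbhs_ballP[e /= e0 eB].
  (* Two hops of length at most [1 / k.+1], through a common grid point, lead from [t] to a point of
     [A]. *)
  pose k := Num.truncn (2 / e).
  have ke : 2 / k.+1%:R < e.
    by rewrite ltr_pdivrMr// mulrC -ltr_pdivrMr// truncnS_gt.
  have [q [y Ay yq] tq] := tA k Logic.I.
  exists y; split => //; apply: eB; split=> // i j; rewrite !mxE ord1.
  rewrite /ball /= /ball_; apply: le_lt_trans ke.
  have := yq j; have := tq j.
  set a := tnth t j; set b := y 0 j; set c := (q 0 j)%:~R / _ => ac bc.
  have -> : a - b = (a - c) - (b - c) by ring.
  apply: le_trans (ler_normB _ _) _.
  rewrite mulr_natl mulr2n.
exact: lerD.
apply: bigcap_measurable => [|k _]; first by exists 0%N.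
rewrite bigcup_mkcond; apply: countable_bigcupT_measurable => // q.
case: ifP => // _.
have -> : near_grid k q =
   \bigcap_(i in @setT 'I_n) [set t | `|tnth t i - (q 0 i)%:~R / k.+1%:R| <= k.+1%:R^-1].
  by apply/seteqP; split=> t /= tq i *; exact: tq.
apply: fin_bigcap_measurable => // i _.
have mi : measurable_fun setT
    (fun t : n.-tuple mR => `|tnth t i - (q 0 i)%:~R / k.+1%:R| : R).
  apply: measurableT_comp => //; apply: measurable_funB => //.
  exact: measurable_tnth.
rewrite -[X in measurable X]setTI.
have := mi measurableT _ (measurable_itv `]-oo, (k.+1%:R^-1 : R)]).
by congr (measurable (_ `&` _)); apply/seteqP; split => t /=; rewrite in_itv.
Qed.

Lemma volumeE n (A : set 'rV[R]_n) :
  volume A = @lebesgue_rec R n [set t | A (\row_i tnth t i)].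
Proof. by rewrite /volume lebesgue_tupleE. Qed.

End volume.

(** * Volume of an absolutely convex hull *)

Section dot_product.
Context {R : realType} {n : nat}.
Implicit Types (x y z : 'rV[R]_n) (a : R).

Lemma dotvC x y : dotv x y = dotv y x.
Proof. by apply: eq_bigr => i _; rewrite mulrC. Qed.

Lemma dotvDl x y z : dotv (x + y) z = dotv x z + dotv y z.
Proof. by rewrite -big_split; apply: eq_bigr => i _; rewrite !mxE mulrDl. Qed.

Lemma dotvZl a x y : dotv (a *: x) y = a * dotv x y.
Proof. by rewrite mulr_sumr; apply: eq_bigr => i _; rewrite !mxE mulrA. Qed.

Lemma dotvDr x y z : dotv x (y + z) = dotv x y + dotv x z.
Proof. by rewrite dotvC dotvDl !(dotvC x). Qed.

Lemma dotvZr a x y : dotv x (a *: y) = a * dotv x y.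
Proof. by rewrite dotvC dotvZl dotvC. Qed.

Lemma dotv_ge0 x : 0 <= dotv x x.
Proof. by apply: sumr_ge0 => i _; rewrite -expr2 sqr_ge0. Qed.

Lemma dotv_shift x y a : dotv (x + a *: y) (x + a *: y) =
  dotv x x + 2 * a * dotv x y + a ^+ 2 * dotv y y.
Proof. rewrite !(dotvDl, dotvDr, dotvZl, dotvZr) (dotvC y x); ring. Qed.

End dot_product.

(** * Rounding coefficients to integers at controlled cost *)

Section rounding.
Context {R : realType} {n : nat} {I : eqType}.
Variables (X : I -> 'rV[R]_n) (a L r : R).
Hypotheses (a0 : 0 <= a) (Xr : forall i, dotv (X i) (X i) <= r).

(* Rounding [t] to one of its two neighbouring integers [m] at random, with mean
   [t], has variance at most [`|t|] and leaves the mean of [`|m|] equal to [`|t|];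
   so one of the two choices does not exceed the expected cost. *)
Lemma rounding_step (v x : 'rV[R]_n) (t : R) : dotv x x <= r ->
  exists m : int, `|m%:~R| <= `|t| + 1 /\
    a * dotv (v + (t - m%:~R) *: x) (v + (t - m%:~R) *: x) + L * `|m%:~R|
      <= a * dotv v v + (a * r + L) * `|t|.
Proof.
move=> xr; set f := Num.floor t.
have /andP[fl fu] := floor_itv t; rewrite -/f intrD in fl fu.
pose th := t - f%:~R.
have th0 : 0 <= th by rewrite /th; lra.
have th1 : th < 1 by rewrite /th; lra.
have dx0 := dotv_ge0 x.
pose cost (m : int) := a * dotv (v + (t - m%:~R) *: x) (v + (t - m%:~R) *: x)
  + L * `|m%:~R|.
(* The neighbours [f] and [f + 1] lie on the same side of 0, so the absolute value is affine between
   them; the second claim bounds the variance. *)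
have absE : (1 - th) * `|f%:~R| + th * `|(f + 1)%:~R| = `|t| :> R /\
    th * (1 - th) <= `|t|.
  rewrite intrD; have [f0|f0] := leP 0 f.
    have f0' : 0 <= f%:~R :> R by rewrite ler0z.
    rewrite !ger0_norm; [|lra..]; split; first by rewrite /th; ring.
    rewrite /th in th0 th1 *; nra.
  have f0' : f%:~R <= -1 :> R by rewrite -(@intrN R 1) ler_int -ltzD1.
  rewrite !ler0_norm; [|lra..]; split; first by rewrite /th; ring.
  rewrite /th in th0 th1 *; nra.
have [absE1 absE2] := absE.
(* The terms linear in the rounding error cancel in the mean, which leaves the variance times
   [dotv x x]. *)
have mean : (1 - th) * cost f + th * cost (f + 1) <=
    a * dotv v v + (a * r + L) * `|t|.
  have -> : (1 - th) * cost f + th * cost (f + 1) =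
      a * (dotv v v + th * (1 - th) * dotv x x) + L * `|t|.
    rewrite -absE1 /cost !dotv_shift !intrD /th; ring.
  have : a * (th * (1 - th) * dotv x x) <= a * (`|t| * r).
    by rewrite ler_wpM2l// ler_pM// mulr_ge0//; lra.
  lra.
have abs_bound : `|f%:~R| <= `|t| + 1 /\ `|(f + 1)%:~R| <= `|t| + 1 :> R.
  by rewrite intrD; split; move: fl fu; case: (ger0P t) => ?; case: ger0P; lra.
have [c0|c0] := leP (cost f) (a * dotv v v + (a * r + L) * `|t|).
  by exists f; split => //; exact: abs_bound.1.
exists (f + 1); split; first exact: abs_bound.2.
(* If both costs exceeded the bound, so would their mean. *)
rewrite -/(cost _) leNgt; apply/negP => c1.
have : 0 < 1 - th by lra.
nra.
Qed.

(** The coefficients are rounded one after another, [v] being the error accumulated so far; each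
    step pays its own share [(a * r + L) * |t i|], and the shares add up. *)
Lemma rounding (s : seq I) (t : I -> R) (v : 'rV[R]_n) : uniq s ->
  exists m : I -> int, (forall i, `|(m i)%:~R| <= `|t i| + 1) /\
    a * dotv (v + \sum_(i <- s) (t i - (m i)%:~R) *: X i)
             (v + \sum_(i <- s) (t i - (m i)%:~R) *: X i)
      + L * \sum_(i <- s) `|(m i)%:~R|
      <= a * dotv v v + (a * r + L) * \sum_(i <- s) `|t i|.
Proof.
elim: s v => [|i s IHs] v /=.
  move=> _; exists (fun=> 0); rewrite !big_nil addr0 !mulr0 !addr0; split => // i.
  by rewrite normr0 addr_ge0.
case/andP=> is_ us.
have [mi [mib mic]] := rounding_step v (t i) (Xr i).
have [m [mb mc]] := IHs (v + (t i - mi%:~R) *: X i) us.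
exists (fun j => if j == i then mi else m j); split.
  by move=> j; case: eqP => [->|_].
have tails j : j \in s -> (if j == i then mi else m j) = m j.
  by case: eqP => // -> ; rewrite (negPf is_).
rewrite !big_cons eqxx addrA.
rewrite (eq_big_seq (fun j => (t j - (m j)%:~R) *: X j)); last first.
  by move=> j js; rewrite tails.
rewrite [in X in _ + L * X](eq_big_seq (fun j => `|(m j)%:~R|)); last first.
  by move=> j js; rewrite tails.
lra.
Qed.

End rounding.

(** * Gaussian densities *)

Section gaussian.
Context {R : realType}.
Local Notation mR := (measurableTypeR R).

(* The standard deviation is such that the exponent is [- k |x - z|^2]. *)
Definition gauss_density n (k : R) (z x : 'rV[R]_n) : R :=
  \prod_i normal_pdf (z 0 i) (Num.sqrt (2 * k))^-1 (x 0 i).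

Lemma gauss_densityE n (k : R) (z x : 'rV[R]_n) : 0 < k ->
  gauss_density k z x =
  Num.sqrt (k / pi) ^+ n * expR (- (k * dotv (x - z) (x - z))).
Proof.
move=> k0; have pi0 := pi_gt0 R.
have s0 : (Num.sqrt (2 * k))^-1 != 0.
  by rewrite invr_neq0// sqrtr_eq0 -ltNge mulr_gt0.
have s2 : (Num.sqrt (2 * k))^-1 ^+ 2 = (2 * k)^-1.
  by rewrite exprVn sqr_sqrtr// mulr_ge0// ltW.
have peak : (Num.sqrt ((2 * k)^-1 * pi *+ 2))^-1 = Num.sqrt (k / pi).
  rewrite -sqrtrV; last by rewrite mulrn_wge0// mulr_ge0 ?invr_ge0 ?mulr_ge0 ?ltW.
  by congr Num.sqrt; field; lra.
rewrite /gauss_density.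
under eq_bigr => i _.
  rewrite normal_pdfE// /normal_peak /normal_fun s2.
  rewrite peak.
  over.
rewrite big_split /= prodr_const card_ord; congr (_ * _).
rewrite -expR_sum; congr expR; rewrite /dotv mulr_sumr -sumrN.
by apply: eq_bigr => i _; rewrite !mxE; field; lra.
Qed.

Lemma gauss_density_ge0 n (k : R) (z x : 'rV[R]_n) : 0 <= gauss_density k z x.
Proof. by apply: prodr_ge0 => i _; exact: normal_pdf_ge0. Qed.

Lemma measurable_gauss_density n (k : R) (z : 'rV[R]_n) :
  measurable_fun setT
    (fun t : n.-tuple mR => gauss_density k z (\row_i tnth t i)).
Proof.
have := @measurable_fun_prod_tnth R n
  (fun i => normal_pdf (z 0 i) (Num.sqrt (2 * k))^-1)
  (fun i => measurable_normal_pdf _ _).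
by apply: eq_measurable_fun => t _; apply: eq_bigr => i _; rewrite mxE.
Qed.

Lemma integral_gauss_density n (k : R) (z : 'rV[R]_n) :
  (\int[@lebesgue_rec R n]_t (gauss_density k z (\row_i tnth t i))%:E = 1)%E.
Proof.
rewrite -[RHS](@integral_prod_density R n
  (fun i => normal_pdf (z 0 i) (Num.sqrt (2 * k))^-1)).
- apply: eq_integral => t _; congr (_%:E).
  by apply: eq_bigr => i _; rewrite mxE.
- by move=> i; exact: measurable_normal_pdf.
- by move=> i x; exact: normal_pdf_ge0.
- by move=> i; exact: integral_normal_pdf.
Qed.

End gaussian.

(** * Covering the absolutely convex hull by a mixture of Gaussians *)

Section volume_absconv.
Context {R : realType} {n N : nat}.
Local Notation mR := (measurableTypeR R).
Variable X : 'I_N -> 'rV[R]_n.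

Definition absconv : set 'rV[R]_n :=
  [set \sum_i l 0 i *: X i | l in [set l : 'rV[R]_N | \sum_i `|l 0 i| <= 1]].

(** The integers from [-J] to [J - 1], indexed by a finite type so that the mixture is a finite sum;
    [Negz j] is [-(j + 1)]. *)
Definition grid_val (J : nat) (u : 'I_J + 'I_J) : int :=
  match u with inl j => Posz j | inr j => Negz j end.

(** Two geometric series, the negative integers contributing an extra factor [q]. *)
Lemma sum_grid_val (J : nat) (q : R) : 0 <= q < 1 ->
  \sum_(u : 'I_J + 'I_J) q ^+ `|grid_val u|%N <= (1 + q) / (1 - q).
Proof.
move=> /andP[q0 q1]; rewrite big_sumType /=.
have geom : \sum_(j < J) q ^+ j <= (1 - q)^-1.
  have : (1 - q) * \sum_(j < J) q ^+ j = 1 - q ^+ J.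
    by rewrite -[RHS]opprB subrX1 -mulNr opprB.
  have qJ : 0 <= q ^+ J by apply: exprn_ge0.
  move=> e; rewrite -[leRHS]mul1r ler_pdivlMr ?subr_gt0// mulrC e; lra.
rewrite mulrDl mul1r lerD//.
under eq_bigr do rewrite exprS.
by rewrite -mulr_sumr ler_wpM2l.
Qed.

Variables (k L r : R).
Hypotheses (k0 : 0 < k) (L0 : 0 < L) (r0 : 0 <= r)
  (Xr : forall i, dotv (X i) (X i) <= r).

(** Rounding a number of size at most [k] gives an integer of size at most [k + 1], which is below
    [J]. *)
Let J := (Num.truncn (k + 1)).+1.
Let center (m : {ffun 'I_N -> 'I_J + 'I_J}) : 'rV[R]_n :=
  k^-1 *: \sum_i (grid_val (m i))%:~R *: X i.
Let weight (m : {ffun 'I_N -> 'I_J + 'I_J}) : R :=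
  \prod_i expR (- L) ^+ `|grid_val (m i)|%N.
(** Cancels the peak of the density and pays for the largest exponent, [r + L * k], that rounding
    can produce. *)
Let mass : R := expR (r + L * k) * Num.sqrt (pi / k) ^+ n.

(** One term of the sum is enough: rounding [k * l] with [a = k^-1] gives integers for which the
    exponents of the Gaussian and of the weight together cost at most [r + L * k]. *)
Let absconv_cover (x : 'rV[R]_n) : absconv x ->
  1 <= \sum_m mass * weight m * gauss_density k (center m) x.
Proof.
case=> l /= l1 <-.
have ki0 : 0 <= k^-1 by rewrite invr_ge0 ltW.
have [m [mb mc]] := @rounding R n 'I_N X k^-1 L r ki0 Xr
  (index_enum 'I_N) (fun i => k * l 0 i) 0 (index_enum_uniq _).
have tk i : `|k * l 0 i| <= k.
  rewrite normrM gtr0_norm//.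
  have l1i : `|l 0 i| <= 1.
    by apply: (le_trans _ l1); rewrite (bigD1 i) //= lerDl sumr_ge0.
  by rewrite ler_piMr// ltW.
have /fin_all_exists[u uE] i : exists u : 'I_J + 'I_J, grid_val u = m i.
  have : (`|m i| < J)%N.
    rewrite -(@ltr_nat R) natr_absz intr_norm.
    apply: (le_lt_trans (mb i)); apply: (le_lt_trans _ (truncnS_gt (k + 1))).
    by rewrite lerD2r.
  case: (m i) => j /= jJ; first by exists (inl (Ordinal jJ)).
  by exists (inr (Ordinal (ltnW jJ))).
pose w : {ffun 'I_N -> 'I_J + 'I_J} := [ffun i => u i].
have wE i : grid_val (w i) = m i by rewrite ffunE.
rewrite (bigD1 w) //= -[leLHS]addr0; apply: lerD; last first.
  apply: sumr_ge0 => v _; rewrite mulr_ge0// ?gauss_density_ge0//.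
  rewrite mulr_ge0//; last by apply: prodr_ge0 => i _; rewrite exprn_ge0 ?expR_ge0.
  by rewrite mulr_ge0 ?expR_ge0// exprn_ge0 ?sqrtr_ge0.
rewrite gauss_densityE//.
have -> : weight w = expR (- (L * \sum_i `|(m i)%:~R|)).
  rewrite /weight mulr_sumr -sumrN expR_sum; apply: eq_bigr => i _.
  by rewrite wE -expRM_natl natr_absz intr_norm mulrN mulrC.
rewrite /mass.
have sqrtK : Num.sqrt (pi / k) ^+ n * Num.sqrt (k / pi) ^+ n = 1.
  rewrite -exprMn -sqrtrM ?divr_ge0 ?pi_ge0 ?(ltW k0)//.
  have := pi_gt0 R => pi0.
  have -> : pi / k * (k / pi) = 1 by rewrite mulrA divfK ?divff ?gt_eqF.
  by rewrite sqrtr1 expr1n.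
have -> a b c d e : (a * b) * c * (d * e) = (b * d) * (a * c * e) :> R by ring.
rewrite sqrtK mul1r -!expRD -[leLHS]expR0 ler_expR.
have -> : \sum_i l 0 i *: X i - center w =
    k^-1 *: \sum_i (k * l 0 i - (m i)%:~R) *: X i.
  rewrite /center.
  under [X in _ - _ *: X]eq_bigr do rewrite wE.
  rewrite -[X in X - _](scalerK (lt0r_neq0 k0)) -scalerBr; congr (_ *: _).
  rewrite scaler_sumr -sumrB; apply: eq_bigr => i _.
  by rewrite scalerA -scalerBl.
rewrite dotvZl dotvZr.
have dotv0 : dotv (0 : 'rV[R]_n) 0 = 0 by rewrite -[X in dotv X](scale0r 0) dotvZl mul0r.
move: mc; rewrite add0r dotv0 mulr0 add0r.
set S := \sum_i _; set D := dotv _ _; set A := \sum_i `|k * _|.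
have Ak : A <= k.
  rewrite /A; under eq_bigr do rewrite normrM.
  by rewrite -mulr_sumr gtr0_norm// ler_piMr// ltW.
have : (k^-1 * r + L) * A <= r + L * k.
  apply: le_trans (_ : (k^-1 * r + L) * k <= _).
    by rewrite ler_wpM2l// addr_ge0 ?mulr_ge0 ?(ltW L0).
  by rewrite mulrDl mulrAC mulVf ?gt_eqF// mul1r.
rewrite mulrA divff ?gt_eqF// mul1r; lra.
Qed.

(** Each density has integral 1, so integrating the cover leaves [mass] times the sum of the
    weights, which factors into [N] equal sums over one integer. *)
Lemma volume_absconv : closed absconv ->
  (volume absconv <= (expR (r + L * k) * Num.sqrt (pi / k) ^+ n
    * ((1 + expR (- L)) / (1 - expR (- L))) ^+ N)%:E)%E.
Proof.
move=> cT; have mT := measurable_closed_tuple cT.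
have weight_ge0 m : 0 <= mass * weight m.
  rewrite mulr_ge0//; last by apply: prodr_ge0 => i _; rewrite exprn_ge0 ?expR_ge0.
  by rewrite mulr_ge0 ?expR_ge0// exprn_ge0 ?sqrtr_ge0.
pose h m (t : n.-tuple mR) : \bar R :=
  ((mass * weight m)%:E * (gauss_density k (center m) (\row_i tnth t i))%:E)%E.
have mh m : measurable_fun setT (h m).
  apply: measurable_funeM; apply/measurable_EFinP.
  exact: measurable_gauss_density.
have h0 m t : (0 <= h m t)%E by rewrite /h -EFinM lee_fin mulr_ge0 ?gauss_density_ge0.
rewrite volumeE -[X in lebesgue_rec n X]setIT -integral_indic//.
apply: le_trans (_ : (\int[@lebesgue_rec R n]_t \sum_m h m t <= _)%E).
  apply: ge0_le_integral => //.
  - by apply/measurable_EFinP; exact: measurable_indic.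
  - exact: emeasurable_sum.
  move=> t _; rewrite indicE.
  have -> : (\sum_m h m t =
      (\sum_m mass * weight m * gauss_density k (center m) (\row_i tnth t i))%R%:E)%E.
    by rewrite -sumEFin; apply: eq_bigr => m _; rewrite [in RHS]EFinM.
  rewrite lee_fin; case: (boolP (t \in _)) => [|_]; last first.
    by apply: sumr_ge0 => m _; rewrite mulr_ge0 ?gauss_density_ge0.
  by rewrite inE; exact: absconv_cover.
rewrite ge0_integral_sum//.
under eq_bigr => m _.
  rewrite /h ge0_integralZl ?lee_fin//; last 2 first.
  - by apply/measurable_EFinP; exact: measurable_gauss_density.
  - by move=> t _; rewrite lee_fin gauss_density_ge0.
  rewrite integral_gauss_density mule1.
  over.
rewrite sumEFin lee_fin -mulr_sumr ler_wpM2l//.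
  by rewrite mulr_ge0 ?expR_ge0// exprn_ge0 ?sqrtr_ge0.
rewrite /weight -(bigA_distr_bigA (fun _ u => expR (- L) ^+ `|grid_val u|%N)) /=.
have q01 : 0 <= expR (- L) < 1.
  by rewrite expR_ge0 /= -[ltRHS]expR0 ltr_expR oppr_lt0.
rewrite prodr_const card_ord lerXn2r ?sum_grid_val// nnegrE.
  by apply: sumr_ge0 => u _; rewrite exprn_ge0 ?expR_ge0.
by case/andP: q01 => q0 q1; apply: divr_ge0; lra.
Qed.

End volume_absconv.

(** * Volume of the bodies containing the points *)

Section symmetric_convex_bodies.
Context {R : realType} {n : nat}.
Implicit Types (A D : set 'rV[R]_n) (x y : 'rV[R]_n).

Lemma convex_setP A : convex_set A <->
  forall x y t, 0 <= t <= 1 -> A x -> A y -> A (t *: x + (1 - t) *: y).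
Proof.
split=> cA x y t.
  move=> /andP[t0 t1] Ax Ay.
  have := cA x y (Itv01 t0 t1); rewrite !inE; exact.
rewrite !inE => Ax Ay; apply: cA => //.
by apply/andP; split; [exact: ge0|exact: le1].
Qed.

Lemma symmetricP A x : A = [set - y | y in A] -> A x -> A (- x).
Proof. by move=> AE Ax; rewrite AE; exists x. Qed.

Lemma symmetric_convex_body0 D : symmetric_convex_body D -> D 0.
Proof.
move=> [[_ /convex_setP cD [x /interior_subset Dx]] sD].
rewrite (_ : 0 = 2^-1 *: x + (1 - 2^-1) *: (- x)).
  by apply: cD => //; [lra|exact: symmetricP].
by rewrite scalerN -scalerBl (_ : 2^-1 - _ = 0) ?scale0r//; lra.
Qed.

(** For [y] interior, [D] contains [y + e *: x] for some [e > 0]; the midpoint of this point and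
    [- y] is a positive multiple of [x]. *)
Lemma symmetric_convex_body_absorbing D x : symmetric_convex_body D ->
  exists2 a : R, 0 < a & [set a *: y | y in D] x.
Proof.
move=> sDb; have [[_ /convex_setP cD [y Dy]] sD] := sDb.
have : \forall e \near (0 : R)^'+, D (y + e *: x).
  have : (y + e *: x) @[e --> 0^'+] --> y.
    rewrite -[X in _ --> X]addr0 -[X in _ --> y + X](scale0r x).
    apply: cvgD; first exact: cvg_cst.
    by apply: cvgZr_tmp; apply: cvg_at_right_filter; exact: cvg_id.
  by apply.
move=> Dnear.
have [e [e0 De]] : exists e, 0 < e /\ D (y + e *: x).
  near (0 : R)^'+ => e; exists e; split; first by near: e; exact: nbhs_right_gt.
  by near: e.
exists (2 / e); first by rewrite divr_gt0.
have e2 : 2 / e * (e / 2) = 1 by rewrite mulrA divfK ?divff ?gt_eqF.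
exists ((e / 2) *: x); last by rewrite scalerA e2 scale1r.
have -> : (e / 2) *: x = 2^-1 *: (y + e *: x) + (1 - 2^-1) *: (- y) :> 'rV[R]_n.
  rewrite scalerDr scalerA scalerN addrAC -scalerBl (_ : 2^-1 - _ = 0); last lra.
  by rewrite scale0r add0r mulrC.
by apply: cD => //; [lra|exact: symmetricP (interior_subset Dy)].
Unshelve. all: by end_near. Qed.

Lemma gauge_le1 D x : D x -> gauge D x <= 1.
Proof.
move=> Dx; apply: ge_inf; first by exists 0 => a [].
by split => //; exists x; rewrite ?scale1r.
Qed.

Lemma gauge_ge1 D x : symmetric_convex_body D -> ~ D x -> 1 <= gauge D x.
Proof.
move=> sDb nDx; apply: lb_le_inf.
  have [a a0 Dax] := symmetric_convex_body_absorbing x sDb.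
  by exists a; split => //; exact: ltW.
move=> a [a0 [y Dy yx]]; rewrite leNgt; apply/negP => a1; apply: nDx.
have [[_ /convex_setP cD _] _] := sDb.
rewrite -yx -[X in D X]addr0 -[X in _ + X](scaler0 _ (1 - a)).
by apply: cD; rewrite ?a0 ?ltW//; exact: symmetric_convex_body0.
Qed.

Lemma gauge_ge0 D x : symmetric_convex_body D -> 0 <= gauge D x.
Proof.
move=> sDb; apply: lb_le_inf; last by move=> a [].
have [a a0 Dax] := symmetric_convex_body_absorbing x sDb.
by exists a; split => //; exact: ltW.
Qed.

End symmetric_convex_bodies.

(** * Measurability of coordinates, scalar products and the sphere *)

Section borel_vectors.
Context {R : realType} {n : nat}.
Local Notation mR := (measurableTypeR R).

Lemma measurable_coord (i : 'I_n) :
  measurable_fun setT (fun x : borel R n => (x : 'rV[R]_n) 0 i).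
Proof.
apply: (measurability _ (RGenOInfty.measurableE R)) => _ [_ [a ->] <-].
rewrite setTI; apply: sub_sigma_algebra.
have /continuousP : continuous (fun x : 'rV[R]_n => x 0 i).
  by move=> x; exact: coord_continuous.
by apply; exact: interval_open.
Qed.

(** Phrased through coordinates so as to serve tuples, Borel vectors and pairs of these alike. *)
Lemma measurable_dotv d (T : measurableType d) (f : T -> 'I_n -> R)
    (g : T -> 'I_n -> R) :
  (forall i, measurable_fun setT (f ^~ i)) ->
  (forall i, measurable_fun setT (g ^~ i)) ->
  measurable_fun setT (fun t => dotv (\row_i f t i) (\row_i g t i)).
Proof.
move=> mf mg; rewrite /dotv.
apply: (@measurable_sum _ _ _ _ _ _
  (fun i t => (\row_i f t i) 0 i * (\row_i g t i) 0 i)) => i.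
apply: measurable_funM.
  by apply: eq_measurable_fun (mf i) => t _; rewrite mxE.
by apply: eq_measurable_fun (mg i) => t _; rewrite mxE.
Qed.

Lemma unit_sphereE : @unit_sphere R n = [set x | dotv x x = 1].
Proof.
apply/seteqP; split => x; rewrite /unit_sphere /=; last by move=> ->; rewrite sqrtr1.
by move=> x1; rewrite -(sqr_sqrtr (dotv_ge0 x)) x1 expr1n.
Qed.

Lemma measurable_unit_sphere : measurable (@unit_sphere R n : set (borel R n)).
Proof.
rewrite unit_sphereE.
have m := measurable_dotv measurable_coord measurable_coord.
rewrite -[X in measurable X]setTI.
have := m measurableT _ (measurable_set1 1).
have rowE (x : 'rV[R]_n) : \row_i x 0 i = x by apply/rowP => i; rewrite mxE.
by congr (measurable (_ `&` _)); apply/seteqP; split => x /=; rewrite rowE.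
Qed.

End borel_vectors.

(** * Inequalities for real powers *)

Section real_powers.
Context {R : realType}.
Implicit Types (u y a p : R).

(** Bernoulli's inequality for real exponents; it follows from [1 + x <= expR x], taken at [- ln u]
    and at [(p - 1) * ln u]. *)
Lemma powR_ge_tangent u p : 0 <= u -> 1 <= p -> 1 + p * (u - 1) <= u `^ p.
Proof.
move=> u0 p1; have [->|u_neq0] := eqVneq u 0.
  by apply: le_trans (powR_ge0 _ _); lra.
have {u0 u_neq0} u0 : 0 < u by rewrite lt_neqAle eq_sym u_neq0.
have uE : expR (ln u) = u by rewrite lnK.
have ulnu : u - 1 <= u * ln u.
  have h : 1 - ln u <= u^-1.
    have -> : u^-1 = expR (- ln u) by rewrite expRN uE.
    by have := expR_ge1Dx (- ln u).
  have : u * (1 - ln u) <= 1.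
    by rewrite -[leRHS](divff (lt0r_neq0 u0)) ler_pM2l.
  lra.
have -> : u `^ p = u * expR ((p - 1) * ln u).
  rewrite -[X in X * expR _]uE -expRD /powR gt_eqF//; congr expR; ring.
have : u * (1 + (p - 1) * ln u) <= u * expR ((p - 1) * ln u).
  by rewrite ler_pM2l// expR_ge1Dx.
apply: le_trans.
have : (p - 1) * (u - 1) <= (p - 1) * (u * ln u) by rewrite ler_wpM2l//; lra.
lra.
Qed.

(** Jensen's inequality for the p-th power, by summing its tangent at [a]; the slope is
    non-negative, so a lower bound on the mean suffices. *)
Lemma power_mean_ge N (y : 'I_N -> R) a p : 0 < a -> 1 <= p ->
  N%:R * a <= \sum_i `|y i| -> N%:R * a `^ p <= \sum_i `|y i| `^ p.
Proof.
move=> a0 p1 sy.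
apply: le_trans (_ : \sum_i a `^ p * (1 + p * (`|y i| / a - 1)) <= _); last first.
  apply: ler_sum => i _.
  rewrite -[X in _ <= X `^ p](@divfK _ a) ?gt_eqF// powRM ?divr_ge0 ?(ltW a0)//.
  by rewrite mulrC ler_wpM2r ?powR_ge0// powR_ge_tangent// divr_ge0// ltW.
rewrite -mulr_sumr mulrC ler_wpM2l ?powR_ge0//.
rewrite big_split /= -mulr_sumr sumrB !sumr_const card_ord -mulr_suml.
rewrite lerDl mulr_ge0//; first lra.
by rewrite subr_ge0 ler_pdivlMr.
Qed.

(** With [u = 8 * |y| / a] this is [u <= expR u] raised to the power [p]. Summing over both signs of
    [y] removes the absolute value from the exponent, which makes the Gaussian integral explicit. *)
Lemma powR_le_expR y a p : 0 < a -> 1 <= p ->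
  `|y| `^ p <= (a / 8) `^ p * (expR (8 * p / a * y) + expR (- (8 * p / a * y))).
Proof.
move=> a0 p1.
pose u := 8 * `|y| / a.
have u0 : 0 <= u by rewrite !mulr_ge0// invr_ge0 ltW.
have a80 : 0 <= a / 8 by rewrite mulr_ge0// ltW.
have -> : `|y| = a / 8 * u by rewrite /u; field; lra.
rewrite powRM//; apply: ler_wpM2l; first exact: powR_ge0.
apply: le_trans (_ : expR u `^ p <= _).
  apply: ge0_ler_powR; rewrite ?nnegrE ?expR_ge0//; first lra.
  apply: le_trans (expR_ge1Dx u); lra.
rewrite -expRM.
have -> : u * p = 8 * p / a * `|y| by rewrite /u; ring.
have c0 : 0 <= 8 * p / a by rewrite !mulr_ge0 ?invr_ge0//; lra.
by case: (ger0P y) => _; rewrite ?mulrN ?lerDl ?lerDr ?expR_ge0.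
Qed.

End real_powers.

(** * Moments of a Gaussian vector in one direction *)

Section gaussian_moment.
Context {R : realType} {n : nat}.
Local Notation mR := (measurableTypeR R).

(** Completing the square: an exponential tilt moves the centre along [th]. *)
Lemma gauss_density_expR (k s : R) (th x : 'rV[R]_n) : 0 < k ->
  dotv th th = 1 ->
  gauss_density k 0 x * expR (s * dotv x th) =
  expR (s ^+ 2 / (4 * k)) * gauss_density k ((s / (2 * k)) *: th) x.
Proof.
move=> k0 th1; rewrite !gauss_densityE// subr0.
rewrite mulrAC -mulrA [RHS]mulrCA -!expRD; congr (_ * expR _).
have -> : x - (s / (2 * k)) *: th = x + (- (s / (2 * k))) *: th by rewrite scaleNr.
rewrite dotv_shift th1; field; lra.
Qed.

(** The variance is tuned so that tilting by [s = 8 * p / a] costs exactly [expR (p / 2)]. The two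
    signs give twice the p-th power of [a / 8] times this cost; as [expR 2^-1 <= 2] and [p >= 1],
    the total is at most half the p-th power of [a]. *)
Lemma gauss_moment (a p : R) (th : 'rV[R]_n) : 0 < a -> 1 <= p ->
  dotv th th = 1 ->
  (\int[@lebesgue_rec R n]_t
     (gauss_density (32 * p / a ^+ 2) 0 (\row_i tnth t i)
       * `|dotv (\row_i tnth t i) th| `^ p)%:E
   <= (2^-1 * a `^ p)%:E)%E.
Proof.
move=> a0 p1 th1.
set k := 32 * p / a ^+ 2; pose s := 8 * p / a.
have k0 : 0 < k by rewrite divr_gt0 ?exprn_gt0// mulr_gt0//; lra.
pose z e : 'rV[R]_n := ((e * s) / (2 * k)) *: th.
pose c : R := (a / 8) `^ p * expR (p / 2).
have c0 : 0 <= c by rewrite mulr_ge0 ?powR_ge0 ?expR_ge0.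
have s2 : s ^+ 2 / (4 * k) = p / 2 by rewrite /s /k; field; lra.
pose h e (t : n.-tuple mR) : \bar R := (gauss_density k (z e) (\row_i tnth t i))%:E.
have mh e : measurable_fun setT (h e).
  by apply/measurable_EFinP; exact: measurable_gauss_density.
have h0 e t : (0 <= h e t)%E by rewrite lee_fin gauss_density_ge0.
apply: le_trans (_ : (\int[@lebesgue_rec R n]_t (c%:E * (h 1%R t + h (-1)%R t)) <= _)%E).
  apply: ge0_le_integral => //.
  - by move=> t _; rewrite lee_fin mulr_ge0 ?gauss_density_ge0 ?powR_ge0.
  - apply/measurable_EFinP; apply: measurable_funM.
      exact: measurable_gauss_density.
    apply: (measurableT_comp (measurable_powR p)) => //.
    apply: measurableT_comp => //.
    have := @measurable_dotv R n _ _ (fun (t : n.-tuple mR) i => tnth t i)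
      (fun _ i => th 0 i) (fun i => measurable_tnth i) (fun i => measurable_cst _).
    apply: eq_measurable_fun => t _; congr (dotv _ _).
    by apply/rowP => i; rewrite mxE.
  - by apply: measurable_funeM; apply: emeasurable_funD.
  - move=> t _; rewrite /h -EFinD -EFinM lee_fin; set x := \row_i _.
    apply: le_trans (ler_wpM2l (gauss_density_ge0 _ _ _)
      (powR_le_expR (dotv x th) a0 p1)) _.
    rewrite -/s mulrCA mulrDr -mulNr !gauss_density_expR// sqrrN s2.
    rewrite /z mul1r mulN1r /c le_eqVlt; apply/orP; left; apply/eqP; ring.
rewrite ge0_integralZl//; [|exact: emeasurable_funD|by move=> t _; rewrite adde_ge0].
rewrite ge0_integralD//.
rewrite !integral_gauss_density -EFinD -EFinM lee_fin.
have e2 : expR 2^-1 <= 2 :> R.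
  rewrite -[leLHS]invrK -expRN -[leRHS]invrK lef_pV2 ?posrE ?expR_gt0//.
  by apply: le_trans (expR_ge1Dx _); lra.
have cE : c <= (a / 4) `^ p.
  rewrite /c [p / 2]mulrC expRM -powRM ?expR_ge0 ?mulr_ge0 ?(ltW a0)//.
  apply: ge0_ler_powR; rewrite ?nnegrE ?mulr_ge0 ?expR_ge0 ?(ltW a0)//; first lra.
  have : a * expR 2^-1 <= a * 2 by rewrite ler_pM2l.
  lra.
have aE : (a / 4) `^ p <= a `^ p * 4^-1.
  rewrite powRM ?(ltW a0)// ler_wpM2l ?powR_ge0// ge1r_powR//; lra.
lra.
Qed.

End gaussian_moment.

(** * Lower bound on the volume of a body in the class *)

Section Lp_ball_volume.
Context {R : realType} {n : nat}.
Local Notation mR := (measurableTypeR R).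
Variables (p a : R) (D : set 'rV[R]_n) (nu : {finite_measure set (borel R n) -> \bar R}).
Hypotheses (p1 : 1 <= p) (a0 : 0 < a) (sD : symmetric_convex_body D).
Hypothesis gaugeE : forall x : 'rV[R]_n,
  ((gauge D x `^ p)%:E =
   \int[nu]_(theta in @unit_sphere R n) (`|dotv x theta| `^ p)%:E)%E.

Let S : set (borel R n) := @unit_sphere R n.
Let p0 : 0 <= p. Proof. exact: le_trans p1. Qed.
Let p_gt0 : 0 < p. Proof. exact: lt_le_trans p1. Qed.
Let one_powR : 1 `^ p = 1 :> R. Proof. by rewrite powR1. Qed.
Let mS : measurable S. Proof. exact: measurable_unit_sphere. Qed.

Let measurable_pow (x : 'rV[R]_n) :
  measurable_fun setT (fun th : borel R n => (`|dotv x th| `^ p)%:E).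
Proof.
apply/measurable_EFinP; apply: (measurableT_comp (measurable_powR p)) => //.
apply: measurableT_comp => //.
have := @measurable_dotv R n _ (borel R n) (fun _ i => x 0 i)
  (fun th i => (th : 'rV[R]_n) 0 i) (fun i => measurable_cst _) measurable_coord.
by apply: eq_measurable_fun => th _; congr (dotv _ _); apply/rowP => i; rewrite mxE.
Qed.

(** The power mean inequality holds at each point of the sphere. Integrated against [nu], its
    right-hand side becomes the sum of the p-th powers of the gauges of the [X i], which is at most
    [N]. *)
Lemma sphere_mass_le N (X : 'I_N -> 'rV[R]_n) : (0 < N)%N ->
  (forall i, D (X i)) ->
  (forall th, dotv th th = 1 -> N%:R * a <= \sum_i `|dotv (X i) th|) ->
  ((a `^ p)%:E * nu S <= 1)%E.
Proof.
move=> N0 DX spread.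
have N0R : 0 < N%:R :> R by rewrite ltr0n.
rewrite -(@lee_pmul2l _ N%:R%:E)// mule1 muleA -EFinM.
apply: le_trans (_ : (\int[nu]_(th in S)
    \sum_i (`|dotv (X i) th| `^ p)%:E <= _)%E).
  rewrite -integral_cst//; apply: ge0_le_integral => //.
  - by move=> th _; rewrite lee_fin mulr_ge0 ?powR_ge0.
  - apply: emeasurable_sum => i; apply: measurable_funTS; exact: measurable_pow.
  move=> th; rewrite /S unit_sphereE /= => th1.
  by rewrite sumEFin lee_fin; apply: power_mean_ge => //; exact: spread.
rewrite ge0_integral_sum//; last first.
  by move=> i; apply: measurable_funTS; exact: measurable_pow.
under eq_bigr do rewrite -gaugeE.
rewrite sumEFin lee_fin.
apply: le_trans (_ : \sum_(i < N) 1 <= _); last by rewrite sumr_const card_ord.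
apply: ler_sum => i _; rewrite -[leRHS]one_powR.
apply: ge0_ler_powR; rewrite ?nnegrE ?gauge_ge0 ?gauge_le1//.
Qed.

(** Markov's inequality for the Gaussian of standard deviation [a / (8 * Num.sqrt p)]: the mass
    outside [D] is at most the mean p-th power of the gauge, hence at most 1/2, and the mass inside
    is at most the peak of the density times the volume. *)
Lemma volume_Lp_ge : ((a `^ p)%:E * nu S <= 1)%E -> (0 < n)%N ->
  (((a / (8 * Num.sqrt p)) ^+ n)%:E <= volume D)%E.
Proof.
move=> nuS n0.
set k := 32 * p / a ^+ 2.
have k0 : 0 < k by rewrite divr_gt0 ?exprn_gt0// mulr_gt0.
pose row (t : n.-tuple mR) : 'rV[R]_n := \row_i tnth t i.
pose g t := gauss_density k 0 (row t).
have g0 t : 0 <= g t by exact: gauss_density_ge0.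
have mg : measurable_fun setT g by exact: measurable_gauss_density.
pose peak := Num.sqrt (k / pi) ^+ n.
have peak_gt0 : 0 < peak by rewrite exprn_gt0// sqrtr_gt0 divr_gt0 ?pi_gt0.
(* The indicator of the sphere belongs to the integrand, so that Tonelli applies on the whole
   product space. *)
pose F (z : n.-tuple mR * borel R n) : \bar R :=
  (g z.1 * (\1_S z.2 * `|dotv (row z.1) z.2| `^ p))%:E.
have F0 z : (0 <= F z)%E by rewrite lee_fin !mulr_ge0 ?powR_ge0.
have mF : measurable_fun setT F.
  apply/measurable_EFinP; apply: measurable_funM.
    exact: measurableT_comp mg measurable_fst.
  apply: measurable_funM.
    by apply: measurableT_comp measurable_snd; exact: measurable_indic.
  apply: (measurableT_comp (measurable_powR p)) => //; apply: measurableT_comp => //.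
  have := @measurable_dotv R n _ (n.-tuple mR * borel R n)%type
    (fun z i => tnth z.1 i) (fun z i => (z.2 : 'rV[R]_n) 0 i)
    (fun i => measurableT_comp (measurable_tnth i) measurable_fst)
    (fun i => measurableT_comp (measurable_coord i) measurable_snd).
  by apply: eq_measurable_fun => z _; congr (dotv _ _); apply/rowP => i; rewrite mxE.
have FE t : (\int[nu]_th F (t, th) = (g t * gauge D (row t) `^ p)%:E)%E.
  rewrite EFinM gaugeE [in RHS]integral_mkcond epatch_indic -ge0_integralZl//.
  - by apply: eq_integral => th _; rewrite /F /= EFinM [in LHS](mulrC (\1_S th)) EFinM.
  - apply: emeasurable_funM; first exact: measurable_pow.
    by apply/measurable_EFinP; exact: measurable_indic.
  - by move=> th _; rewrite -EFinM lee_fin mulr_ge0 ?powR_ge0.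
  - by rewrite lee_fin.
have [[compactD _ _] _] := sD.
have mT := measurable_closed_tuple (compact_closed (@norm_hausdorff _ _) compactD).
set A := [set t : n.-tuple mR | D (row t)] in mT.
have cover t : g t <= peak * \1_A t + g t * gauge D (row t) `^ p.
  rewrite indicE; case: (boolP (t \in A)) => [_|]; last first.
    rewrite notin_setE => nD; rewrite mulr0 add0r ler_peMr//.
    rewrite -[leLHS]one_powR.
    by apply: ge0_ler_powR; rewrite ?nnegrE ?gauge_ge0 ?gauge_ge1//.
  rewrite mulr1 -[leLHS]addr0 lerD// ?mulr_ge0 ?powR_ge0//.
  rewrite /g gauss_densityE// ler_piMr//.
  by rewrite -[leRHS]expR0 ler_expR oppr_le0 mulr_ge0 ?dotv_ge0// ltW.
have total : (1 <= peak%:E * volume D + (2^-1)%:E)%E.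
  rewrite -(@integral_gauss_density R n k 0).
  apply: le_trans (_ : (\int[@lebesgue_rec R n]_t
     ((peak * \1_A t)%:E + fubini_F nu F t) <= _)%E).
    apply: ge0_le_integral => //.
    - by move=> t _; rewrite lee_fin gauss_density_ge0.
    - exact/measurable_EFinP.
    - apply: emeasurable_funD; last exact: measurable_fun_fubini_tonelli_F.
      by apply/measurable_EFinP; apply: measurable_funM => //; exact: measurable_indic.
    - move=> t _; rewrite /fubini_F FE -EFinD lee_fin; exact: cover.
  rewrite ge0_integralD//; last 4 first.
  - by move=> t _; rewrite lee_fin mulr_ge0 ?(ltW peak_gt0).
  - by apply/measurable_EFinP; apply: measurable_funM => //; exact: measurable_indic.
  - by move=> t _; apply: integral_ge0.
  - exact: measurable_fun_fubini_tonelli_F.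
  apply: leeD.
    under eq_integral do rewrite EFinM.
    rewrite ge0_integralZl ?lee_fin ?(ltW peak_gt0)//.
    - by rewrite integral_indic// setIT volumeE.
    - by apply/measurable_EFinP; exact: measurable_indic.
  rewrite fubini_tonelli//.
  apply: le_trans (_ : (\int[nu]_th ((2^-1 * a `^ p)%:E * (\1_S th)%:E) <= _)%E).
    apply: ge0_le_integral => //.
    - by move=> th _; apply: integral_ge0.
    - exact: measurable_fun_fubini_tonelli_G.
    - by apply: measurable_funeM; apply/measurable_EFinP; exact: measurable_indic.
    move=> th _; rewrite indicE; case: (boolP (th \in S)) => [|thS].
      rewrite inE /S unit_sphereE /= => th1.
      rewrite mule1; apply: le_trans (gauss_moment a0 p1 th1).
      rewrite le_eqVlt; apply/orP; left; apply/eqP; apply: eq_integral => t _.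
      by rewrite /F /= indicE mem_set ?mul1r// /S unit_sphereE.
    rewrite mule0 integral0_eq// => t _.
    by rewrite /F /= indicE (negbTE thS) mul0r mulr0.
  rewrite ge0_integralZl//; last 2 first.
  - by apply/measurable_EFinP; exact: measurable_indic.
  - by rewrite lee_fin mulr_ge0 ?powR_ge0.
  rewrite integral_indic// setIT EFinM -muleA.
  by rewrite -[leRHS]mule1 lee_pmul2l.
have vD : (((2 * peak)^-1)%:E <= volume D)%E.
  have : (2^-1%:E <= peak%:E * volume D)%E.
    move: total; case: (volume D) => [v| |].
    - by rewrite -EFinM -EFinD !lee_fin; lra.
    - by rewrite mulry gtr0_sg// mul1e => _; exact: leey.
    - by rewrite mulrNy gtr0_sg// mul1e.
  by move=> h; rewrite invfM EFinM [leLHS]muleC lee_pdivrMl.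
apply: le_trans vD; rewrite lee_fin.
rewrite [leRHS]invfM /peak -exprVn -sqrtrV ?divr_ge0 ?pi_ge0 ?(ltW k0)//.
(* One factor [2^-1] per dimension pays for the single [2^-1] left by Markov, since [n] is positive;
   what remains is [pi / 2 >= 1]. *)
apply: le_trans (_ : (2^-1 * (a / (4 * Num.sqrt p))) ^+ n <= _).
  rewrite le_eqVlt; apply/orP; left; apply/eqP; congr (_ ^+ _).
  by rewrite !invfM; field; rewrite gt_eqF ?sqrtr_gt0.
rewrite exprMn; apply: ler_pM.
- by rewrite exprn_ge0.
- by rewrite exprn_ge0// divr_ge0 ?mulr_ge0 ?sqrtr_ge0 ?ltW.
- by apply: ler_iXnr => //; lra.
apply: lerXn2r; rewrite ?nnegrE ?sqrtr_ge0 ?divr_ge0 ?mulr_ge0 ?sqrtr_ge0 ?(ltW a0)//.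
rewrite -[leLHS]gtr0_norm ?divr_gt0 ?mulr_gt0 ?sqrtr_gt0// -sqrtr_sqr ler_wsqrtr//.
rewrite expr_div_n exprMn sqr_sqrtr ?(ltW p_gt0)// /k invf_div.
have piE (q : R) : q / (32 * p / a ^+ 2) = q / 2 * (a ^+ 2 / (4 ^+ 2 * p)).
  by field; rewrite !gt_eqF.
rewrite piE.
rewrite ler_peMl ?divr_ge0 ?sqr_ge0 ?mulr_ge0//.
- by rewrite ler_pdivlMr// mul1r pi_ge2.
- by rewrite mulr_ge0.
- exact: sqr_ge0.
Qed.

End Lp_ball_volume.

(** * Random signs *)

Section rademacher.
Context {R : realType}.
Implicit Types (e th : nat -> R) (G : (nat -> R) -> R) (H : R -> R).

Definition set_coord e k (v : R) : nat -> R := fun i => if i == k then v else e i.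

(* Expectation of [G e] for independent uniform signs [e 0, ..., e n.-1]; the
   remaining coordinates of [e] are [1]. *)
Fixpoint sign_mean n G : R :=
  match n with
  | 0 => G (fun=> 1)
  | n'.+1 => (sign_mean n' (fun e => G (set_coord e n' 1))
            + sign_mean n' (fun e => G (set_coord e n' (-1)))) / 2
  end.

Lemma sign_meanD n G1 G2 :
  sign_mean n (fun e => G1 e + G2 e) = sign_mean n G1 + sign_mean n G2.
Proof. by elim: n G1 G2 => //= n IHn G1 G2; rewrite !IHn; field. Qed.

Lemma sign_meanZ n c G : sign_mean n (fun e => c * G e) = c * sign_mean n G.
Proof. by elim: n G => //= n IHn G; rewrite !IHn; field. Qed.

Lemma sign_mean_cst n c : sign_mean n (fun=> c) = c.
Proof. by elim: n => //= n ->; field. Qed.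

Lemma sign_mean_sum n (I : finType) (P : pred I) (G : I -> (nat -> R) -> R) :
  sign_mean n (fun e => \sum_(i | P i) G i e) = \sum_(i | P i) sign_mean n (G i).
Proof.
elim: n G => //= n IHn G; rewrite !IHn -big_split /= mulr_suml.
by apply: eq_bigr.
Qed.

Lemma ler_sign_mean n G1 G2 :
  (forall e, G1 e <= G2 e) -> sign_mean n G1 <= sign_mean n G2.
Proof.
by elim: n G1 G2 => //= n IHn G1 G2 G12; rewrite ler_pM2r// lerD ?IHn.
Qed.

(** Of the two values of the last sign, the one with the smaller conditional mean is kept. *)
Lemma sign_mean_witness n G :
  exists2 e, forall i, `|e i| = 1 & G e <= sign_mean n G.
Proof.
elim: n G => /= [|n IHn] G; first by exists (fun=> 1) => // i; rewrite normr1.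
set m1 := sign_mean n _; set m2 := sign_mean n _.
have [m12|m21] := leP m1 m2.
  have [e e1 eG] := IHn (fun e => G (set_coord e n 1)).
  exists (set_coord e n 1); last by apply: le_trans eG _; rewrite -/m1; lra.
  by move=> i; rewrite /set_coord; case: ifP; rewrite ?normr1.
have [e e1 eG] := IHn (fun e => G (set_coord e n (-1))).
exists (set_coord e n (-1)); last by apply: le_trans eG _; rewrite -/m2; lra.
by move=> i; rewrite /set_coord; case: ifP; rewrite ?normrN1.
Qed.

Definition sign_sum n th e : R := \sum_(i < n) e i * th i.

Lemma sign_sumS n th e v :
  sign_sum n.+1 th (set_coord e n v) = sign_sum n th e + v * th n.
Proof.
rewrite /sign_sum big_ord_recr /= {2}/set_coord eqxx; congr (_ + _).
by apply: eq_bigr => i _; rewrite /set_coord ltn_eqF.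
Qed.

Lemma sign_mean_sumS n th H :
  sign_mean n.+1 (fun e => H (sign_sum n.+1 th e)) =
  sign_mean n (fun e => 2^-1 * (H (sign_sum n th e + th n)
                              + H (sign_sum n th e - th n))).
Proof.
rewrite /= sign_meanZ sign_meanD mulrC; congr (_ * (_ + _)).
  by congr sign_mean; apply/funext => e; rewrite sign_sumS mul1r.
by congr sign_mean; apply/funext => e; rewrite sign_sumS mulN1r.
Qed.

Lemma sign_mean_sqr n th :
  sign_mean n (fun e => sign_sum n th e ^+ 2) = \sum_(i < n) th i ^+ 2.
Proof.
elim: n => [|n IHn]; first by rewrite /= /sign_sum !big_ord0 expr0n.
rewrite (sign_mean_sumS n th (fun y => y ^+ 2)).
rewrite big_ord_recr /= -IHn -[X in _ + X](sign_mean_cst n) -sign_meanD.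
by congr sign_mean; apply/funext => e; field.
Qed.

(** Khintchine's inequality for the fourth moment: odd powers of the last sign cancel, and
    [3 s^2 + 6 s t^2 + t^4 <= 3 (s + t^2)^2]. *)
Lemma sign_mean_pow4 n th :
  sign_mean n (fun e => sign_sum n th e ^+ 4) <= 3 * (\sum_(i < n) th i ^+ 2) ^+ 2.
Proof.
elim: n => [|n IHn]; first by rewrite /= /sign_sum !big_ord0 !expr0n mulr0.
rewrite (sign_mean_sumS n th (fun y => y ^+ 4)).
have -> : (fun e => 2^-1 * ((sign_sum n th e + th n) ^+ 4
                          + (sign_sum n th e - th n) ^+ 4))
  = (fun e => sign_sum n th e ^+ 4
      + (6 * th n ^+ 2 * sign_sum n th e ^+ 2 + th n ^+ 4)).
  by apply/funext => e; field.
rewrite !sign_meanD sign_meanZ sign_mean_cst sign_mean_sqr big_ord_recr /=.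
set s := \sum_(i < n) _ in IHn *.
have : 0 <= th n ^+ 2 ^+ 2 by rewrite sqr_ge0.
rewrite -exprM; nra.
Qed.

(** An even quartic majorant, so that second and fourth moments control the mean of the left-hand
    side. It comes from [expR (- u) <= 1 / (1 + u)] and a polynomial inequality. *)
Lemma expRN_le_quartic (y : R) : expR (- `|y|) <= 1 - (y ^+ 2 - y ^+ 4 / 12) / 5.
Proof.
have -> : y ^+ 4 = `|y| ^+ 4 by rewrite -normrX ger0_norm// exprn_even_ge0.
rewrite -(real_normK (num_real y)); have : 0 <= `|y| by [].
move: `|y| => u u0.
have eu : expR (- u) * (1 + u) <= 1.
  have uV : expR (- u) * expR u = 1 by rewrite -expRD addNr expR0.
  by rewrite -[leRHS]uV ler_wpM2l ?expR_ge0// expR_ge1Dx.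
have quartic : 1 <= (1 - (u ^+ 2 - u ^+ 4 / 12) / 5) * (1 + u).
  (* Five times the difference of the two sides, written as a sum of non-negative terms. *)
  have : 0 <= u * ((u ^+ 2 - 6) ^+ 2 / 12 + ((u - 2) ^+ 2 * (u + 4) / 12 + 2 / 3)).
    apply: mulr_ge0 => //; apply: addr_ge0.
      by rewrite divr_ge0// sqr_ge0.
    apply: addr_ge0; last lra.
    by rewrite divr_ge0// mulr_ge0 ?sqr_ge0//; lra.
  lra.
rewrite -(@ler_pM2r _ (1 + u)); last lra.
exact: le_trans eu quartic.
Qed.

(** The moments bound the mean by [1 - (s - s^2 / 4) / 5], where [s] is the squared norm; on the
    allowed range [s - s^2 / 4] is smallest at [s = 1/2], with value 7/16. The range leaves room for
    grid points that are only nearly unit. *)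
Lemma sign_mean_expRN n th : 2^-1 <= \sum_(i < n) th i ^+ 2 <= 2 ->
  sign_mean n (fun e => expR (- `|sign_sum n th e|)) <= expR (- (2 / 25)).
Proof.
move=> /andP[sl su].
apply: le_trans (_ : sign_mean n (fun e => 1 + ((- 5^-1) * sign_sum n th e ^+ 2
    + 60^-1 * sign_sum n th e ^+ 4)) <= _).
  apply: ler_sign_mean => e; apply: le_trans (expRN_le_quartic _) _.
  by rewrite le_eqVlt; apply/orP; left; apply/eqP; field.
rewrite !sign_meanD !sign_meanZ sign_mean_cst sign_mean_sqr.
have := sign_mean_pow4 n th; have := expR_ge1Dx (- (2 / 25) : R).
move: sl su; set s := \sum_(i < n) _ => sl su e1 m4.
have : 7 / 16 <= s - s ^+ 2 / 4 by nra.
lra.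
Qed.

(** Method of conditional expectations: the sign vectors are chosen one at a time, each multiplying
    the total weight by at most [expR (- (2 / 25))]. *)
Lemma sign_vectors_weights n (I : finType) (P : pred I) (th : I -> nat -> R) N :
  (forall i, P i -> 2^-1 <= \sum_(j < n) th i j ^+ 2 <= 2) ->
  exists2 e : nat -> nat -> R, forall k j, `|e k j| = 1 &
    \sum_(i | P i) \prod_(k < N) expR (- `|sign_sum n (th i) (e k)|)
      <= #|I|%:R * expR (- (2 / 25)) ^+ N.
Proof.
move=> thP; elim: N => [|N [e e1 eN]].
  exists (fun _ _ => 1) => [k j|]; first by rewrite normr1.
  rewrite expr0 mulr1; under eq_bigr do rewrite big_ord0.
  by rewrite sumr_const ler_nat max_card.
pose c i := \prod_(k < N) expR (- `|sign_sum n (th i) (e k)|).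
have c0 i : 0 <= c i by apply: prodr_ge0 => k _; exact: expR_ge0.
have [f f1 fG] := sign_mean_witness n (fun f =>
  \sum_(i | P i) c i * expR (- `|sign_sum n (th i) f|)).
exists (fun k => if k == N then f else e k).
  by move=> k j; case: ifP.
under eq_bigr => i _.
  rewrite big_ord_recr /= eqxx.
  under eq_bigr => k _ do rewrite (ltn_eqF (ltn_ord k)).
  over.
apply: le_trans fG _; rewrite sign_mean_sum.
under eq_bigr do rewrite sign_meanZ.
rewrite exprSr mulrA; apply: le_trans (_ : (\sum_(i | P i) c i) * expR (- (2 / 25)) <= _).
  by rewrite mulr_suml; apply: ler_sum => i Pi; rewrite ler_wpM2l// sign_mean_expRN ?thP.
by rewrite ler_wpM2r ?expR_ge0.
Qed.

End rademacher.

(** * Sign vectors that are spread in every direction *)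

Section spreading.
Context {R : realType}.

Lemma dotv_coord_le1 n (th : 'rV[R]_n) i : dotv th th = 1 -> `|th 0 i| <= 1.
Proof.
move=> th1; rewrite -(@ler_pXn2r _ 2)// ?nnegrE// expr1n real_normK ?num_real//.
rewrite -th1 /dotv (bigD1 i) //= expr2 lerDl.
by apply: sumr_ge0 => j _; rewrite -expr2 sqr_ge0.
Qed.

Definition grid_point (M : nat) (u : 'I_(2 * M).+1) : R := (u%:R - M%:R) / M%:R.

Lemma grid_point_near (M : nat) (x : R) : (0 < M)%N -> `|x| <= 1 ->
  exists u : 'I_(2 * M).+1, `|x - grid_point u| <= M%:R^-1.
Proof.
move=> M0; rewrite ler_norml => /andP[x1 x2].
have M0R : 0 < M%:R :> R by rewrite ltr0n.
have y0 : 0 <= (x + 1) * M%:R by rewrite mulr_ge0//; lra.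
have /andP[tl tu] := truncn_itv y0; rewrite -natr1 in tu.
have uM : (Num.truncn ((x + 1) * M%:R) < (2 * M).+1)%N.
  rewrite ltnS -(@ler_nat R) natrM; apply: le_trans tl _.
  by rewrite ler_pM2r//; lra.
exists (Ordinal uM); rewrite /grid_point /=.
set t := (Num.truncn _)%:R in tl tu *.
have -> : x - (t - M%:R) / M%:R = ((x + 1) * M%:R - t) / M%:R by field; lra.
rewrite normrM [X in _ * X]ger0_norm ?invr_ge0// ler_piMl ?invr_ge0//.
by rewrite ger0_norm; lra.
Qed.

(** The union bound over the grid gives [N / 25] at every grid point of nearly unit norm; moving to
    the unit vector [th] loses at most [1 / 50] per sign vector. *)
Lemma sign_vectors_spread n N : (0 < n)%N ->
  ((100 * n).+1 ^ n)%:R < expR (N%:R / 25) :> R ->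
  exists2 X : 'I_N -> 'rV[R]_n, forall k i, `|X k 0 i| = 1 &
    forall th, dotv th th = 1 -> N%:R * 50^-1 <= \sum_k `|dotv (X k) th|.
Proof.
move=> n0 netN.
have n0R : 0 < n%:R :> R by rewrite ltr0n.
(* Mesh [1 / (50 n)] makes the total coordinate error at most [1 / 50], which bounds the change of
   the scalar product with any sign vector. *)
pose M := (50 * n)%N.
have M0 : (0 < M)%N by rewrite muln_gt0.
have ME : M%:R = 50 * n%:R :> R by rewrite natrM.
pose I := {ffun 'I_n -> 'I_(2 * M).+1}.
(* Sign sums take sequences indexed by natural numbers, so grid points are extended by 0. *)
pose pt (u : I) (j : nat) : R := if insub j is Some j' then grid_point (u j') else 0.
have ptE (u : I) (j : 'I_n) : pt u j = grid_point (u j) by rewrite /pt valK.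
pose P (u : I) := 2^-1 <= \sum_(j < n) pt u j ^+ 2 <= 2.
have [e e1 eN] := @sign_vectors_weights R n I P pt N (fun u => id).
exists (fun k => \row_j e k j) => [k j|th th1]; first by rewrite mxE.
have /fin_all_exists[u thu] j :=
  grid_point_near M0 (dotv_coord_le1 j th1).
pose w : I := [ffun j => u j].
have near j : `|th 0 j - pt w j| <= (50 * n%:R)^-1 by rewrite -ME ptE ffunE.
have sumn (c : R) : \sum_(j < n) c = n%:R * c.
  by rewrite sumr_const card_ord [RHS]mulr_natl.
have n1 : 1 <= n%:R :> R by rewrite ler1n.
(* Each square moves by at most [3 / (50 n)], so the squared norm stays within 3/50 of 1. *)
have Pw : P w.
  have : `|\sum_(j < n) pt w j ^+ 2 - 1| <= 2^-1.
    rewrite -[X in `|_ - X|]th1 /dotv -sumrB; apply: le_trans (ler_norm_sum _ _ _) _.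
    apply: le_trans (_ : \sum_(j < n) 3 * (50 * n%:R)^-1 <= _).
      apply: ler_sum => j _; have := near j; have := dotv_coord_le1 j th1.
      have : (50 * n%:R)^-1 <= 1 :> R by rewrite invf_le1; lra.
      set a := th 0 j; set b := pt w j; set d := _^-1 => d1 a1 ab.
      have -> : b ^+ 2 - a * a = (b - a) * (b + a) by ring.
      rewrite normrM distrC mulrC ler_pM//.
      have -> : b + a = 2 * a - (a - b) by ring.
      apply: le_trans (ler_normB _ _) _; rewrite normrM ger0_norm//; lra.
    rewrite sumn.
    have -> : n%:R * (3 * (50 * n%:R)^-1) = 3 / 50 :> R by field; rewrite gt_eqF.
    lra.
  by rewrite ler_norml /P => /andP[? ?]; apply/andP; split; lra.
(* Otherwise the weight of [w] alone would exceed [expR (- (N / 25))], while the total weight is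
   below it by the bound on the size of the grid. *)
have sum_w : N%:R / 25 <= \sum_(k < N) `|sign_sum n (pt w) (e k)|.
  rewrite leNgt; apply/negP => small.
  have : expR (- (N%:R / 25)) <
      \sum_(v | P v) \prod_(k < N) expR (- `|sign_sum n (pt v) (e k)|).
    rewrite (bigD1 w) //=.
    apply: lt_le_trans (_ : expR (- \sum_(k < N) `|sign_sum n (pt w) (e k)|) <= _).
      by rewrite ltr_expR ltrN2.
    rewrite -sumrN expR_sum lerDl; apply: sumr_ge0 => v _.
    by apply: prodr_ge0 => k _; exact: expR_ge0.
  move=> /lt_le_trans/(_ eN).
  apply/negP; rewrite -leNgt -expRM_natl.
  have -> : expR (- (N%:R / 25)) = expR (N%:R / 25) * expR (N%:R * - (2 / 25)) :> R.
    by rewrite -expRD; congr expR; field.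
  rewrite ler_pM2r ?expR_gt0//.
  by apply: ltW; move: netN; rewrite card_ffun !card_ord /M mulnA.
have approx (k : 'I_N) :
    `|sign_sum n (pt w) (e k)| <= `|dotv (\row_j e k j) th| + 50^-1.
  have err : `|sign_sum n (pt w) (e k) - dotv (\row_j e k j) th| <= 50^-1.
    rewrite /sign_sum /dotv -sumrB; apply: le_trans (ler_norm_sum _ _ _) _.
    apply: le_trans (_ : \sum_(j < n) (50 * n%:R)^-1 <= _).
      apply: ler_sum => j _.
      by rewrite mxE -mulrBr normrM e1 mul1r distrC.
    by rewrite sumn invfM mulrCA divff ?gt_eqF// mulr1.
  rewrite -[X in `|X|](subrK (dotv (\row_j e k j) th)) addrC.
  by apply: le_trans (ler_normD _ _) _; rewrite lerD2l.
have : \sum_(k < N) `|sign_sum n (pt w) (e k)| <=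
    \sum_(k < N) (`|dotv (\row_j e k j) th| + 50^-1) by exact: ler_sum.
rewrite big_split /= sumr_const card_ord -[_ *+ N]mulr_natl.
lra.
Qed.

End spreading.

(** * The body *)

Section absconv_body.
Context {R : realType} {n N : nat}.
Variable X : 'I_N -> 'rV[R]_n.

Lemma absconv_point i : absconv X (X i).
Proof.
exists (delta_mx 0 i) => /=.
  rewrite (bigD1 i) //= big1 => [|j ji]; last by rewrite !mxE (negPf ji) andbF normr0.
  by rewrite !mxE !eqxx normr1 addr0.
rewrite (bigD1 i) //= big1 => [|j ji]; last by rewrite !mxE (negPf ji) andbF scale0r.
by rewrite !mxE !eqxx scale1r addr0.
Qed.

Lemma absconv_convex : convex_set (absconv X).
Proof.
apply/convex_setP => _ _ t /andP[t0 t1] [l /= l1 <-] [l' /= l'1 <-].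
exists (t *: l + (1 - t) *: l') => /=.
  apply: le_trans (_ : t * \sum_i `|l 0 i| + (1 - t) * \sum_i `|l' 0 i| <= _).
    rewrite !mulr_sumr -big_split; apply: ler_sum => i _ /=.
    rewrite !mxE; apply: le_trans (ler_normD _ _) _.
    by rewrite !normrM (ger0_norm t0) (@ger0_norm _ (1 - t)) ?subr_ge0.
  have : t * \sum_i `|l 0 i| <= t by rewrite ler_piMr.
  have : (1 - t) * \sum_i `|l' 0 i| <= 1 - t by rewrite ler_piMr// subr_ge0.
  lra.
rewrite !scaler_sumr -big_split; apply: eq_bigr => i _ /=.
by rewrite !mxE [LHS]scalerDl !scalerA.
Qed.

Lemma absconvN x : absconv X x -> absconv X (- x).
Proof.
move=> [l /= l1 <-]; exists (- l) => /=.
  by under eq_bigr do rewrite mxE normrN.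
by rewrite -sumrN; apply: eq_bigr => i _; rewrite mxE scaleNr.
Qed.

(** A continuous image of the l1 ball of coefficients, which is closed inside a compact cube. *)
Lemma absconv_compact : compact (absconv X).
Proof.
have coordc i : continuous (fun l : 'rV[R]_N => l 0 i) by exact: coord_continuous.
apply: continuous_compact.
  apply: continuous_subspaceT.
  apply: continuous_big => [|i _ l]; first exact: add_continuous.
  by apply: cvgZr_tmp; [exact: (nbhs_filter l)|exact: coordc].
pose box := [set v : 'rV[R]_N | forall i, `[(-1 : R), 1]%classic (v ord0 i)].
have box_compact : compact box.
  by apply: (@rV_compact _ _ (fun=> `[(-1 : R), 1]%classic)) => i; exact: segment_compact.
apply: (subclosed_compact _ box_compact).
  have -> : [set l : 'rV[R]_N | \sum_i `|l 0 i| <= 1] =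
      (fun l => \sum_i `|l 0 i|) @^-1` [set y | y <= 1] by [].
  apply: preimage_closed; last exact: closed_le.
  move=> l _; apply: continuous_big => [|i _ {}l]; first exact: add_continuous.
  by apply: cvg_norm; [exact: (nbhs_filter l)|exact: coordc].
move=> l /= l1 i; suff : l ord0 i \in `[(-1 : R), 1] by [].
rewrite in_itv /= -ler_norml; apply: (le_trans _ l1).
by rewrite (bigD1 i) //= lerDl sumr_ge0.
Qed.

(** The unit vectors among the points give the interior: a vector with coordinates at most
    [1 / n.+1] has l1 norm at most 1. *)
Lemma absconv_symmetric_body (k : 'I_n -> 'I_N) :
  (forall i, X (k i) = delta_mx 0 i) -> symmetric_convex_body (absconv X).
Proof.
move=> Xk; split; last first.
  apply/seteqP; split => x; last by move=> [y Ty <-]; exact: absconvN.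
  by move=> Tx; exists (- x); rewrite ?opprK//; exact: absconvN.
split; [exact: absconv_compact|exact: absconv_convex|].
exists 0; apply/nbhs_ballP; exists n.+1%:R^-1 => /=; first by rewrite invr_gt0.
move=> x [_ x_small].
have xi i : `|x 0 i| <= n.+1%:R^-1.
  by have := x_small 0 i; rewrite /ball /= mxE sub0r normrN => /ltW.
(* Distinct [i] may share an index [k i], so coefficients are collected over the fibres of [k]. *)
have fibres (V : nmodType) (F : 'I_n -> V) :
    \sum_j \sum_(i | k i == j) F i = \sum_i F i.
  by rewrite [RHS](partition_big k xpredT).
exists (\row_j \sum_(i | k i == j) x 0 i) => /=.
  apply: le_trans (_ : \sum_j \sum_(i | k i == j) `|x 0 i| <= _).
    by apply: ler_sum => j _; rewrite mxE ler_norm_sum.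
  rewrite fibres.
  apply: le_trans (_ : \sum_(i < n) n.+1%:R^-1 <= _); first exact: ler_sum.
  by rewrite sumr_const card_ord -[_ *+ n]mulr_natl ler_pdivrMr// mul1r ler_nat.
rewrite [RHS]row_sum_delta -fibres; apply: eq_bigr => j _.
by rewrite mxE scaler_suml; apply: eq_bigr => i /eqP <-; rewrite Xk.
Qed.

End absconv_body.

(** * The random body and its volume *)

Section sign_body.
Context {R : realType}.

(** Makes [ln (ln n)] positive from [n = 3] on. The proof bounds [1 / e] below by the sixth power of
    [5 / 6], which exceeds [1 / 3]. *)
Lemma ln3_gt1 : 1 < ln 3 :> R.
Proof.
rewrite -[ltLHS]expRK ltr_ln ?posrE ?expR_gt0//.
rewrite -[ltLHS]invrK -[ltRHS]invrK ltf_pV2 ?posrE ?invr_gt0 ?expR_gt0//.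
pose x : R := expR (- 6^-1).
have -> : (expR 1)^-1 = x ^+ 2 * x ^+ 2 * x ^+ 2 :> R.
  by rewrite -!exprD -expRN -expRM_natl; congr expR; field.
have x1 : 5 / 6 <= x by apply: le_trans (expR_ge1Dx _); lra.
have x2 : 25 / 36 <= x ^+ 2 by nra.
have x4 : 12 / 25 < x ^+ 2 * x ^+ 2 by nra.
nra.
Qed.

(** Number of sign vectors per dimension; 25 matches the exponent [N / 25] of the union bound, and
    the logarithm is that of the number of grid values of a coordinate. *)
Definition sign_count (n : nat) : nat :=
  (Num.truncn (25 * ln ((100 * n).+1%:R : R))).+1.

Lemma sign_count_large n : (0 < n)%N ->
  ((100 * n).+1 ^ n)%:R < expR ((sign_count n * n)%:R / 25) :> R.
Proof.
move=> n0; have n0R : 0 < n%:R :> R by rewrite ltr0n.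
have q0 : 0 < (100 * n).+1%:R :> R by [].
rewrite natrX -[X in X ^+ n < _](@lnK R) ?posrE// -expRM_natl ltr_expR.
rewrite natrM mulrAC [ltRHS]mulrC ltr_pM2l// ltr_pdivlMr// mulrC.
exact: truncnS_gt.
Qed.

(** The quotient absorbs the additive [ln 202] into a multiple of [ln (ln n)], which is at least
    [ln (ln 3)]. *)
Definition loglog_const : R := ln 202 / ln (ln 3) + 1.

Lemma ln_sign_count n : (3 <= n)%N ->
  ln (sign_count n).+1%:R <= loglog_const * ln (ln n%:R) :> R.
Proof.
move=> n3; have ln3 := ln3_gt1.
have n3R : 3 <= n%:R :> R by rewrite ler_nat.
have l_ge : ln 3 <= ln n%:R :> R by rewrite ler_ln ?posrE//; lra.
set l : R := ln n%:R in l_ge *.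
have q1 : 0 <= 25 * ln (100 * n).+1%:R :> R.
  by rewrite mulr_ge0// ln_ge0// ler1n.
have /andP[tq _] := truncn_itv q1.
(* Here [100 n + 1] is at most [2 ^ 7 * n]. *)
have lnq : ln (100 * n).+1%:R <= 7 + l :> R.
  have ln2 : ln 2 <= 1 :> R by apply: (@le_ln1Dx _ (1 : R)); lra.
  apply: le_trans (_ : ln (2 ^+ 7) + l <= _); last first.
    by rewrite lnXn// -[_ *+ 7]mulr_natl; lra.
  rewrite /l -lnM ?posrE ?exprn_gt0//; last lra.
  rewrite ler_ln ?posrE ?mulr_gt0 ?exprn_gt0//; last lra.
  rewrite -natrX -natrM ler_nat; apply: (@leq_trans (100 * n + n)).
    by rewrite -addn1 leq_add2l (leq_trans _ n3).
  by rewrite -mulSnr leq_mul2r orbT.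
(* The count is at most [25 * (7 + l) + 2], and [l > 1] turns this into [202 * l]. *)
have countE : (sign_count n).+1%:R <= 202 * l :> R.
  have -> : (sign_count n).+1%:R =
      (Num.truncn (25 * ln ((100 * n).+1%:R : R)))%:R + 2 :> R.
    by rewrite /sign_count -[_.+2]addn2 natrD.
  lra.
have l0 : 0 < l by lra.
have lnl : ln (ln 3) <= ln l by rewrite ler_ln ?posrE//; lra.
have lnln3 : 0 < ln (ln 3) :> R by exact: ln_gt0.
apply: le_trans (_ : ln (202 * l) <= _).
  by rewrite ler_ln ?posrE// mulr_gt0.
rewrite lnM ?posrE// /loglog_const mulrDl mul1r lerD2r mulrAC ler_pdivlMr//.
by rewrite ler_wpM2l// ln_ge0//; lra.
Qed.

(** Adding the [n] unit vectors at most doubles the number of points, so the spreading constant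
    drops from 1/50 to 1/100. *)
Lemma sign_body_exists n : (0 < n)%N ->
  exists X : 'I_(sign_count n * n + n) -> 'rV[R]_n,
    [/\ forall i, dotv (X i) (X i) <= n%:R,
        symmetric_convex_body (absconv X) &
        forall th, dotv th th = 1 ->
          (sign_count n * n + n)%:R * 100^-1 <= \sum_i `|dotv (X i) th|].
Proof.
move=> n0; set m := sign_count n.
have [Y Y1 Yspread] := sign_vectors_spread n0 (sign_count_large n0).
pose X (k : 'I_(m * n + n)) : 'rV[R]_n :=
  match fintype.split k with inl j => Y j | inr i => delta_mx 0 i end.
have Xl j : X (lshift n j) = Y j.
  by rewrite /X -[lshift n j]/(unsplit (inl j)) unsplitK.
have Xr i : X (rshift (m * n) i) = delta_mx 0 i.
  by rewrite /X -[rshift _ i]/(unsplit (inr i)) unsplitK.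
have n1 : 1 <= n%:R :> R by rewrite ler1n.
exists X; split.
- move=> k; rewrite /X; case: (fintype.split k) => j.
    rewrite /dotv; under eq_bigr do rewrite -expr2 -real_normK ?num_real// Y1 expr1n.
    by rewrite sumr_const card_ord.
  rewrite /dotv (bigD1 j) //= big1 ?addr0 ?mxE ?eqxx ?mulr1//.
  by move=> i ij; rewrite mxE (negPf ij) andbF mulr0.
- exact: (absconv_symmetric_body Xr).
move=> th th1; rewrite big_split_ord /=.
under eq_bigr do rewrite Xl.
apply: le_trans (_ : (m * n)%:R * 50^-1 + 0 <= _); last first.
  by rewrite lerD ?Yspread// sumr_ge0.
have : n%:R <= (m * n)%:R :> R by rewrite ler_nat leq_pmull.
by rewrite natrD; lra.
Qed.

(** The choice [k = n / L], [r = n] makes the exponent [r + L * k] equal to [2 n]; with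
    [expR (- L) = 1 / m.+1] the sum of the weights is at most [expR (4 n)], whence [expR 6] per
    dimension. The factor 2 bounds the square root of [pi]. *)
Lemma volume_sign_body n (X : 'I_(sign_count n * n + n) -> 'rV[R]_n) : (0 < n)%N ->
  (forall i, dotv (X i) (X i) <= n%:R) -> closed (absconv X) ->
  (volume (absconv X) <=
   ((2 * expR 6 * Num.sqrt (ln (sign_count n).+1%:R / n%:R)) ^+ n)%:E)%E.
Proof.
move=> n0 Xn cX; set m := sign_count n.
have n0R : 0 < n%:R :> R by rewrite ltr0n.
have m0R : 0 < m%:R :> R by rewrite ltr0n.
set L : R := ln m.+1%:R.
have L0 : 0 < L by rewrite ln_gt0// ltr1n.
have k0 : 0 < n%:R / L by rewrite divr_gt0.
apply: le_trans (volume_absconv k0 L0 (ltW n0R) Xn cX) _.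
rewrite lee_fin mulrCA mulfV ?gt_eqF// mulr1.
have qE : expR (- L) = m.+1%:R^-1 by rewrite expRN lnK ?posrE.
rewrite qE.
have ratioE (x : R) : 0 < x -> (1 + (x + 1)^-1) / (1 - (x + 1)^-1) = 1 + 2 / x.
  move=> x0; have x1 : x + 1 != 0 by rewrite gt_eqF//; lra.
  have -> : 1 - (x + 1)^-1 = x / (x + 1) by field.
  by field; rewrite x1 gt_eqF.
rewrite -natr1 ratioE//.
have fugacity : (1 + 2 / m%:R) ^+ (m * n + n) <= expR (4 * n%:R) :> R.
  apply: le_trans (_ : expR (2 / m%:R) ^+ (m * n + n) <= _).
    by rewrite lerXn2r ?nnegrE ?expR_ge0 ?expR_ge1Dx ?addr_ge0 ?divr_ge0.
  rewrite -expRM_natl ler_expR natrD natrM.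
  have -> : (m%:R * n%:R + n%:R) * (2 / m%:R) = 2 * n%:R + 2 * n%:R / m%:R :> R.
    by field; rewrite gt_eqF.
  have : 2 * n%:R / m%:R <= 2 * n%:R :> R.
    rewrite ler_pdivrMr// ler_peMr ?mulr_ge0//; last by rewrite ler1n.
  lra.
have sqrt_le : Num.sqrt (pi / (n%:R / L)) <= 2 * Num.sqrt (L / n%:R).
  have -> : pi / (n%:R / L) = pi * (L / n%:R) by rewrite invf_div.
  rewrite sqrtrM ?pi_ge0// ler_wpM2r ?sqrtr_ge0//.
  have -> : 2 = Num.sqrt (2 ^+ 2) :> R by rewrite sqrtr_sqr ger0_norm.
  by rewrite ler_wsqrtr// expr2 -ler_pdivrMr// ltW// pihalf_lt2.
have -> : (2 * expR 6 * Num.sqrt (L / n%:R)) ^+ n =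
    expR (n%:R + n%:R) * (2 * Num.sqrt (L / n%:R)) ^+ n * expR (4 * n%:R).
  rewrite [LHS](_ : _ = expR 6 ^+ n * (2 * Num.sqrt (L / n%:R)) ^+ n); last first.
    by rewrite -exprMn mulrCA mulrA.
  rewrite mulrAC -expRD -expRM_natl; congr (expR _ * _); ring.
apply: ler_pM => //.
rewrite ler_wpM2l ?expR_ge0// lerXn2r ?nnegrE ?sqrtr_ge0//.
Qed.

End sign_body.

(** * From the two volume bounds to the outer volume ratio *)

Lemma outer_ratio_ge (R : realType) (n : nat) (vD vT : \bar R) (a b : R) :
  (0 < n)%N -> 0 < a -> 0 < b -> (0 <= vT)%E ->
  ((a ^+ n)%:E <= vD)%E -> (vT <= (b ^+ n)%:E)%E ->
  ((a / b)%:E <= (vD / vT) `^ (n%:R^-1))%E.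
Proof.
move=> n0 a0 b0 vT0 aD Tb.
have n0R : n%:R != 0 :> R by rewrite pnatr_eq0 -lt0n.
have ab0 : 0 <= a / b by rewrite divr_ge0 ?ltW.
have ratio : (((a / b) ^+ n)%:E <= vD / vT)%E.
  rewrite expr_div_n EFinM; apply: lee_pmul => //.
  - by rewrite lee_fin exprn_ge0// ltW.
  - by rewrite lee_fin invr_ge0 exprn_ge0// ltW.
  rewrite (_ : (b ^+ n)^-1%:E = ((b ^+ n)%:E^-1)%E); last first.
    by rewrite inver gt_eqF ?exprn_gt0.
  by rewrite lee_pV2 ?inE ?lee_fin ?exprn_ge0 ?(ltW b0).
have -> : a / b = ((a / b) ^+ n) `^ (n%:R^-1).
  by rewrite -powR_mulrn// -powRrM mulfV// powRr1.
rewrite -poweR_EFin; apply: gt0_ler_poweR => //.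
- by rewrite in_itv /= leey lee_fin exprn_ge0.
- by rewrite in_itv /= leey (le_trans _ ratio)// lee_fin exprn_ge0.
Qed.

Theorem corollary1p8 (R : realType) :
  exists c : R, 0 < c /\
    forall n : nat, (3 <= n)%N ->
      exists T : set 'rV[R]_n, symmetric_convex_body T /\
        forall p : R, 1 <= p ->
          ((c * (Num.sqrt n%:R / Num.sqrt (p * ln (ln n%:R))))%:E
             <= d_ovr T (Lp_class p))%E.
Proof.
have lnln3 : 0 < ln (ln 3) :> R by rewrite ln_gt0// ln3_gt1.
pose K : R := Num.sqrt (loglog_const (R := R)).
have C0 : 0 < loglog_const (R := R).
  by rewrite /loglog_const ltr_wpDl//; apply: divr_ge0;
    [rewrite ln_ge0 ?ler1n|exact: ltW].
have K0 : 0 < K by rewrite sqrtr_gt0.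
(* Here 100 comes from the spreading, 8 from the lower bound on the volume of [D], [2 * expR 6] from
   the upper bound for the hull, and [K] from replacing [ln (sign_count n).+1] by [ln (ln n)] under
   the square root. *)
exists ((100 * 8 * 2 * expR 6 * K)^-1); split.
  by rewrite invr_gt0 !mulr_gt0 ?expR_gt0.
move=> n n3; have n0 : (0 < n)%N by exact: leq_trans n3.
have n0R : 0 < n%:R :> R by rewrite ltr0n.
have [X [Xn Tbody Xspread]] := sign_body_exists (R := R) n0.
exists (absconv X); split => // p p1.
have p_gt0 : 0 < p by exact: lt_le_trans p1.
have cX : closed (absconv X).
  by apply: compact_closed; [exact: norm_hausdorff|exact: absconv_compact].
have vT := volume_sign_body n0 Xn cX.
set L : R := ln (sign_count n).+1%:R in vT.
have L0 : 0 < L by rewrite ln_gt0// ltr1n.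
have LC : L <= loglog_const * ln (ln n%:R) by exact: ln_sign_count.
set l : R := ln (ln n%:R) in LC *.
have l0 : 0 < l by rewrite -(pmulr_rgt0 _ C0); exact: lt_le_trans LC.
apply: le_ereal_inf_tmp => _ [D [TD [Dbody [nu gaugeE]]] <-].
have a0 : 0 < 100^-1 :> R by [].
have nuS := sphere_mass_le (N := (sign_count n * n + n)%N) p1 a0 Dbody gaugeE
  (X := X) _ (fun i => TD _ (absconv_point X i)) Xspread.
have {nuS}vD := volume_Lp_ge p1 a0 Dbody gaugeE (nuS _) n0.
have sp0 : 0 < Num.sqrt p by rewrite sqrtr_gt0.
apply: le_trans (outer_ratio_ge n0 _ _ _ (vD _) vT).
- rewrite lee_fin.
  have sn0 : 0 < Num.sqrt n%:R :> R by rewrite sqrtr_gt0.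
  have sL0 : 0 < Num.sqrt L by rewrite sqrtr_gt0.
  have sl0 : 0 < Num.sqrt l by rewrite sqrtr_gt0.
  have e0 : 0 < expR 6 :> R by exact: expR_gt0.
  have sLK : Num.sqrt L <= K * Num.sqrt l.
    by rewrite -sqrtrM ?(ltW C0)// ler_wsqrtr.
  have -> : Num.sqrt (L / n%:R) = Num.sqrt L / Num.sqrt n%:R.
    by rewrite sqrtrM ?(ltW L0)// sqrtrV.
  rewrite sqrtrM ?(ltW p_gt0)//.
  pose w := Num.sqrt n%:R / (100 * 8 * 2 * expR 6 * Num.sqrt p).
  have w0 : 0 <= w by rewrite !(mulr_ge0, invr_ge0, sqrtr_ge0) ?expR_ge0.
  have -> : (100 * 8 * 2 * expR 6 * K)^-1 *
      (Num.sqrt n%:R / (Num.sqrt p * Num.sqrt l)) = w * (K * Num.sqrt l)^-1.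
    by rewrite /w; field; rewrite !gt_eqF.
  have -> : 100^-1 / (8 * Num.sqrt p) /
      (2 * expR 6 * (Num.sqrt L / Num.sqrt n%:R)) = w * (Num.sqrt L)^-1.
    by rewrite /w; field; rewrite !gt_eqF.
  by rewrite ler_wpM2l// lef_pV2// posrE// mulr_gt0.
- by rewrite divr_gt0// mulr_gt0.
- by rewrite !mulr_gt0 ?expR_gt0 ?sqrtr_gt0 ?divr_gt0.
- by rewrite volumeE.
- by rewrite addn_gt0 n0 orbT.
Qed.
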